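(* Let $r>0$ and let $\mu$ be an in-homogeneous self-similar measure on $\mathbb{R}^q$ belonging to Case (i) or Case (ii) (as defined in the context), with associated numbers $\xi_{1,r},\xi_{2,r}>0$ and $\xi_r=\max\{\xi_{1,r},\xi_{2,r}\}$. Then $\overline{Q}_r^{\xi_r}(\mu)<\infty$ if and only if $\xi_{1,r}\neq\xi_{2,r}$. As a consequence, $$e^r_{n,r}(\mu)\asymp n^{-\frac{r}{\xi_r}}\quad\text{if}\quad \xi_{1,r}\neq\xi_{2,r}.$$
   Context: **In-homogeneous self-similar measures (ISM).** Let $N\ge 2$ and let $(f_i)_{i=1}^N$ be contractive similitudes on $\mathbb{R}^q$ with contraction ratios $(s_i)_{i=1}^N$, $s_i\in(0,1)$. Let $E$ be the associated self-similar set, i.e. the unique non-empty compact set with $E=f_1(E)\cup\cdots\cup f_N(E)$. Let $\nu$ be a Borel probability measure on $\mathbb{R}^q$ with compact support $C$, and $(p_i)_{i=0}^N$ a probability vector with $p_i>0$ for all $0\le i\le N$. There is a unique Borel probability measure $\mu$ with $\mu=p_0\nu+\sum_{i=1}^N p_i\,\mu\circ f_i^{-1}$; it is called the ISM associated with $(f_i)_{i=1}^N$, $(p_i)_{i=0}^N$ and $\nu$. For contractive similitudes $(g_i)_{i=1}^M$ and a probability vector $(t_i)_{i=1}^M$, the associated self-similar measure is the unique Borel probability measure $\nu$ with $\nu=\sum_{i=1}^M t_i\,\nu\circ g_i^{-1}$. The family $(g_i)_{i=1}^M$ satisfies the open set condition (OSC) if there is a non-empty bounded open set $U$ such that the sets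 $g_i(U)$, $1\le i\le M$, are pairwise disjoint and $\bigcup_{i=1}^M g_i(U)\subset U$. **Case (i).** $(f_i)_{i=1}^N$ satisfies the OSC, and $\nu$ is the self-similar measure associated with the same family $(f_i)_{i=1}^N$ and a probability vector $(t_i)_{i=1}^N$ with all $t_i>0$. In this case $\xi_{1,r},\xi_{2,r}$ are the positive numbers defined by $$\sum_{i=1}^N(t_is_i^r)^{\frac{\xi_{1,r}}{\xi_{1,r}+r}}=1,\qquad \sum_{i=1}^N(p_is_i^r)^{\frac{\xi_{2,r}}{\xi_{2,r}+r}}=1.$$ **Case (ii).** $M\ge 2$, $(g_i)_{i=1}^M$ are contractive similitudes on $\mathbb{R}^q$ with contraction ratios $(c_i)_{i=1}^M$ satisfying the OSC, $\nu$ is the self-similar measure associated with $(g_i)_{i=1}^M$ and a probability vector $(t_i)_{i=1}^M$ with all $t_i>0$ (so $C$ is the self-similar set of $(g_i)_{i=1}^M$), and there exists a bounded non-empty open set $U\subset\mathbb{R}^q$ such that (1) $\bigcup_{i=1}^N f_i(U)\subset U$ and $f_i(U)\cap f_j(U)=\emptyset$ for $1\le i\ne j\le N$; (2) $E\cap U\ne\emptyset$ and $C\subset U$; (3) $\nu(\partial U)=0$, and $C\cap f_i(\mathrm{cl}(U))=\emptyset$ for all $1\le i\le N$. In this case $\xi_{1,r},\xi_{2,r}$ are the positive numbers defined by $$\sum_{i=1}^M(t_ic_i^r)^{\frac{\xi_{1,r}}{\xi_{1,r}+r}}=1,\qquad \sum_{i=1}^N(p_is_i^r)^{\frac{\xi_{2,r}}{\xi_{2,r}+r}}=1.$$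 In both cases $\xi_r:=\max\{\xi_{1,r},\xi_{2,r}\}$. **Quantization.** For a Borel probability measure $P$ on $\mathbb{R}^q$ and $n\ge1$, the $n$th quantization error of order $r$ is $$e_{n,r}(P)=\inf_{\alpha\subset\mathbb{R}^q,\ 1\le \mathrm{card}(\alpha)\le n}\Big(\int d(x,\alpha)^r\,dP(x)\Big)^{1/r},$$ where $d(x,\alpha)$ is the Euclidean distance from $x$ to $\alpha$; $e_{n,r}^r(P)$ denotes $(e_{n,r}(P))^r$. For $s>0$ the $s$-dimensional upper quantization coefficient of order $r$ is $\overline{Q}_r^s(P)=\limsup_{n\to\infty}n^{r/s}e_{n,r}^r(P)$. **Asymptotic notation.** For sequences $(a_n),(b_n)$: $a_n\asymp b_n$ means that there are constants $B_1,B_2>0$ with $B_1b_n\le a_n\le B_2 b_n$ for all large $n$. *)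

(* Defs.v *)
From mathcomp Require Import all_boot all_order all_algebra.
From mathcomp Require Import all_classical all_reals all_analysis.

Set Implicit Arguments.
Unset Strict Implicit.
Unset Printing Implicit Defensive.

Import Order.TTheory GRing.Theory Num.Theory.
Import numFieldNormedType.Exports.

Local Open Scope classical_set_scope.
Local Open Scope ring_scope.

(* R^q is 'rV[R]_q. The norm `|x| of the library on 'rV[R]_q is the sup norm:
   it is only used through notions on which all norms agree (open, closed,
   compact and bounded sets). Metric notions use the Euclidean norm below. *)
Definition enorm (R : realType) (q : nat) (x : 'rV[R]_q) : R :=
  Num.sqrt (\sum_(i < q) x ord0 i ^+ 2).

(* R^q with its Borel sigma-algebra. *)
Notation borel_rV R q := (g_sigma_algebraType (@open 'rV[R]_q)).

(* The topological support: the complement of the largest open null set. *)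
Definition msupport (R : realType) (q : nat)
    (P : probability (borel_rV R q) R) : set 'rV[R]_q :=
  [set x | forall V : set 'rV[R]_q, open V -> V x -> (0 < P V)%E].

Definition contractive_similitude (R : realType) (q : nat)
    (f : 'rV[R]_q -> 'rV[R]_q) (s : R) : Prop :=
  0 < s < 1 /\ forall x y, enorm (f x - f y) = s * enorm (x - y).

Definition positive_probability_vector (R : realType) (n : nat)
    (p : 'I_n -> R) : Prop :=
  (forall i, 0 < p i) /\ \sum_(i < n) p i = 1.

(* The sets, measures and exponents below are the unique solutions of their
   defining equations; the predicates state the equations only. *)
Definition is_self_similar_set (R : realType) (q n : nat)
    (f : 'I_n -> 'rV[R]_q -> 'rV[R]_q) (E : set 'rV[R]_q) : Prop :=
  [/\ E !=set0, compact E & E = \bigcup_(i in [set: 'I_n]) (f i @` E)].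

Definition is_self_similar_measure (R : realType) (q n : nat)
    (g : 'I_n -> 'rV[R]_q -> 'rV[R]_q) (t : 'I_n -> R)
    (nu : probability (borel_rV R q) R) : Prop :=
  forall A : set (borel_rV R q), measurable A ->
    nu A = (\sum_(i < n) (t i)%:E * nu (g i @^-1` A))%E.

(* The weight p_0 of nu is p ord0, and the weight of f i is
   p (lift ord0 i) = p_(i+1), the maps being numbered from 0. *)
Definition is_ISM (R : realType) (q n : nat)
    (f : 'I_n -> 'rV[R]_q -> 'rV[R]_q) (p : 'I_n.+1 -> R)
    (nu mu : probability (borel_rV R q) R) : Prop :=
  forall A : set (borel_rV R q), measurable A ->
    mu A = ((p ord0)%:E * nu A
            + \sum_(i < n) (p (lift ord0 i))%:E * mu (f i @^-1` A))%E.

(* U is a non-empty bounded open set witnessing the open set condition. *)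
Definition OSC_set (R : realType) (q n : nat)
    (g : 'I_n -> 'rV[R]_q -> 'rV[R]_q) (U : set 'rV[R]_q) : Prop :=
  [/\ U !=set0, bounded_set U, open U,
      (forall i j : 'I_n, i != j -> (g i @` U) `&` (g j @` U) = set0)
    & \bigcup_(i in [set: 'I_n]) (g i @` U) `<=` U].

Definition OSC (R : realType) (q n : nat)
    (g : 'I_n -> 'rV[R]_q -> 'rV[R]_q) : Prop :=
  exists U : set 'rV[R]_q, OSC_set g U.

Definition is_exponent (R : realType) (r : R) (n : nat)
    (w s : 'I_n -> R) (xi : R) : Prop :=
  0 < xi /\ \sum_(i < n) (w i * s i `^ r) `^ (xi / (xi + r)) = 1.

Definition case_i (R : realType) (q N : nat) (r : R)
    (f : 'I_N -> 'rV[R]_q -> 'rV[R]_q) (s : 'I_N -> R)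
    (nu : probability (borel_rV R q) R) (xi1 : R) : Prop :=
  OSC f /\
  exists t : 'I_N -> R,
    [/\ positive_probability_vector t,
        is_self_similar_measure f t nu
      & is_exponent r t s xi1].

Definition case_ii (R : realType) (q N : nat) (r : R)
    (f : 'I_N -> 'rV[R]_q -> 'rV[R]_q) (E : set 'rV[R]_q)
    (nu : probability (borel_rV R q) R) (xi1 : R) : Prop :=
  (exists (M : nat) (g : 'I_M -> 'rV[R]_q -> 'rV[R]_q) (c t : 'I_M -> R),
    [/\ (2 <= M)%N,
        (forall i, contractive_similitude (g i) (c i)) /\ OSC g,
        positive_probability_vector t,
        is_self_similar_measure g t nu
      & is_exponent r t c xi1]) /\
  (exists U : set 'rV[R]_q,
    [/\ OSC_set f U,
        E `&` U !=set0 /\ msupport nu `<=` U,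
        nu (closure U `\` interior U) = 0%E
      & forall i : 'I_N, msupport nu `&` (f i @` closure U) = set0]).

Definition eucl_dist (R : realType) (q : nat) (x : 'rV[R]_q)
    (alpha : set 'rV[R]_q) : R :=
  inf [set enorm (x - a) | a in alpha].

(* [set alpha | ...] is the set of non-empty subsets of R^q with at most n
   elements; it is empty for n = 0, so that the error is then +oo. *)
Definition quantization_error (R : realType) (q : nat)
    (P : probability (borel_rV R q) R) (r : R) (n : nat) : \bar R :=
  ereal_inf [set ((\int[P]_x (eucl_dist x alpha `^ r)%:E) `^ r^-1)%E
    | alpha in [set alpha : set 'rV[R]_q |
                 alpha !=set0 /\ (alpha #<= `I_n)%card]].

Definition upper_quantization_coefficient (R : realType) (q : nat)
    (P : probability (borel_rV R q) R) (r s : R) : \bar R :=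
  limn_esup (fun n : nat =>
    ((n%:R `^ (r / s))%R%:E * (quantization_error P r n) `^ r)%E).

Definition same_order (R : realType) (a b : nat -> \bar R) : Prop :=
  exists B1 B2 : R, [/\ 0 < B1, 0 < B2 &
    \forall n \near \oo, (B1%:E * b n <= a n)%E /\ (a n <= B2%:E * b n)%E].

(* Main.v *)
Require Import Defs.
From mathcomp Require Import all_boot all_order all_algebra.
From mathcomp Require Import all_classical all_reals all_analysis.
From mathcomp Require Import measurable_realfun.
From mathcomp Require Import ring lra.
Import Order.TTheory GRing.Theory Num.Theory.
Import numFieldNormedType.Exports.

Set Implicit Arguments.
Unset Strict Implicit.
Unset Printing Implicit Defensive.

Local Open Scope classical_set_scope.
Local Open Scope ring_scope.

(** Write [a i = p (i+1) * s i ^ r] and [b i = t i * c i ^ r] for the weights of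
    the two systems and [th k = xi k / (xi k + r)], so that the sum of
    [a i ^ th2] and the sum of [b i ^ th1] are both [1]. The piece of [mu]
    carried by [f_w (g_v C)] has mass of order [p_w * t_v] and diameter of order
    [s_w * c_v], hence costs about [a_w * b_v] when it is served by one point.
    Everything comes down to counting the pairs [(w, v)] of cost about [1 / x].

    Upper bound. One point per piece of cost at most [1 / x] serves [nu] with
    [O(x ^ th1)] points at error [O(x ^ (th1 - 1))] ([self_similar_upper]). For
    [mu] the count [G] has to satisfy [G x >= C x ^ th1 + sum_i G (a i * x)]; it
    is solved by [A x ^ th2 + B x ^ th1] as soon as the sum of [a i ^ th1] is not
    [1], that is, as soon as the exponents differ ([ISM_upper]). Taking [x] with
    [x ^ th] of the order of the number of points gives the rate ([upper_rate]).

    Lower bound. If there are twice as many separated balls as points, half of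
    the balls are missed and each contributes its cost ([separated_lower],
    [lower_rate]). Separation of the pieces of a system under the open set
    condition is Schief's theorem ([strong_separation]): some point of the support
    of [nu] has images under incomparable words that are apart in proportion to
    their ratios. In the second case, the separation for the [f i], and for pairs
    of words, comes from the set [U] ([margin_separation]). Words of one system
    alone give the rates with [xi1] and [xi2] ([orbit_lower_rate]).

    Equal exponents. Now the number of pieces of cost about [1 / x] is at least
    [L x ^ th] for every [L], which makes the coefficient infinite
    ([pair_lower_unbounded]). If the two systems live apart, every length of the
    prefix [w] contributes [x ^ th] pieces ([case_distinct_unbounded]). If they
    coincide, pieces with the same product word [w ++ v] merge, and the weight of
    a word is a sum over its cuts ([split_weight]); the vectors [a] and [b] differ,
    so the terms of distinct cuts are large on essentially disjoint sets of
    words, and the sum of the [th]-th powers still grows linearly with the length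
    ([sum_dominating], [case_same_unbounded]). *)

(** * Euclidean geometry *)

Section euclid.
Context (R : realType) (q : nat).
Implicit Types (x y z : 'rV[R]_q) (c : R).

Definition dotp x y : R := \sum_(i < q) x ord0 i * y ord0 i.

Lemma dotpC x y : dotp x y = dotp y x.
Proof. by apply: eq_bigr => i _; rewrite mulrC. Qed.

Lemma dotpDl x y z : dotp (x + y) z = dotp x z + dotp y z.
Proof. by rewrite -big_split; apply: eq_bigr => i _; rewrite mxE mulrDl. Qed.

Lemma dotpZl c x y : dotp (c *: x) y = c * dotp x y.
Proof. by rewrite mulr_sumr; apply: eq_bigr => i _; rewrite mxE mulrA. Qed.

Lemma dotpBl x y z : dotp (x - y) z = dotp x z - dotp y z.
Proof. by rewrite -scaleN1r dotpDl dotpZl mulN1r. Qed.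

Lemma dotpp_ge0 x : 0 <= dotp x x.
Proof. by apply: sumr_ge0 => i _; rewrite -expr2 sqr_ge0. Qed.

Lemma enorm_ge0 x : 0 <= enorm x.
Proof. exact: sqrtr_ge0. Qed.

Lemma enormE x : enorm x = Num.sqrt (dotp x x).
Proof. by congr Num.sqrt; apply: eq_bigr => i _; rewrite expr2. Qed.

Lemma enorm_sqr x : enorm x ^+ 2 = dotp x x.
Proof. by rewrite enormE sqr_sqrtr ?dotpp_ge0. Qed.

Lemma enormZ c x : enorm (c *: x) = `|c| * enorm x.
Proof.
by rewrite !enormE dotpZl dotpC dotpZl mulrA -expr2 sqrtrM ?sqr_ge0// sqrtr_sqr.
Qed.

Lemma enormN x : enorm (- x) = enorm x.
Proof. by rewrite -scaleN1r enormZ normrN1 mul1r. Qed.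

Lemma enormC x y : enorm (x - y) = enorm (y - x).
Proof. by rewrite -enormN opprB. Qed.

Lemma enorm0 : enorm (0 : 'rV[R]_q) = 0.
Proof. by rewrite -(scale0r 0) enormZ normr0 mul0r. Qed.

Lemma enorm_eq0 x : enorm x = 0 -> x = 0.
Proof.
move=> x0; have /eqP : dotp x x = 0 by rewrite -enorm_sqr x0 expr0n.
rewrite psumr_eq0; last by move=> i _; rewrite -expr2 sqr_ge0.
move=> /allP h; apply/rowP => i; rewrite mxE; apply/eqP.
by have := h i (mem_index_enum _); rewrite implyTb mulf_eq0 orbb.
Qed.

(** Cauchy-Schwarz, from the sign of the quadratic form at one point. *)
Lemma dotp_le x y : dotp x y <= enorm x * enorm y.
Proof.
have [y0|y0] := eqVneq (enorm y) 0.
  by rewrite (enorm_eq0 y0) dotpC -(scale0r 0) dotpZl mul0r enormZ normr0 mul0r mulr0.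
have [x0|x0] := eqVneq (enorm x) 0.
  by rewrite (enorm_eq0 x0) -(scale0r 0) dotpZl mul0r enormZ normr0 !mul0r.
have yp : 0 < enorm y by rewrite lt_def y0 enorm_ge0.
have xp : 0 < enorm x by rewrite lt_def x0 enorm_ge0.
have := dotpp_ge0 (enorm y *: x - enorm x *: y).
rewrite dotpBl !dotpZl ![dotp _ (_ - _)]dotpC !dotpBl !dotpZl (dotpC y x).
rewrite -!enorm_sqr; set a := enorm x; set b := enorm y; set d := dotp x y.
rewrite (_ : _ - _ = 2 * (a * b) * (a * b - d)); last by rewrite !expr2; ring.
by rewrite pmulr_rge0 ?subr_ge0// mulr_gt0// mulr_gt0.
Qed.

Lemma ler_enormD x y : enorm (x + y) <= enorm x + enorm y.
Proof.
rewrite -(@ler_pXn2r _ 2)// ?nnegrE ?addr_ge0 ?enorm_ge0//.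
rewrite sqrrD !enorm_sqr dotpDl ![dotp _ (_ + _)]dotpC !dotpDl (dotpC y x).
by have := dotp_le x y; lra.
Qed.

Lemma enorm_triangle y x z : enorm (x - z) <= enorm (x - y) + enorm (y - z).
Proof. by rewrite (le_trans _ (ler_enormD _ _))// addrA subrK. Qed.

Lemma ler_enorm_dist x y : `|enorm x - enorm y| <= enorm (x - y).
Proof.
rewrite ler_norml lerBDr; apply/andP; split.
  by have := ler_enormD (y - x) x; rewrite subrK enormC; lra.
by have := ler_enormD (x - y) y; rewrite subrK; lra.
Qed.

Lemma ler_coord_enorm x i : `|x ord0 i| <= enorm x.
Proof.
rewrite -sqrtr_sqr enormE ler_wsqrtr// /dotp (bigD1 i)//= -expr2 lerDl.
by apply: sumr_ge0 => j _; rewrite -expr2 sqr_ge0.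
Qed.

Lemma ler_norm_enorm x : `|x| <= enorm x.
Proof.
rewrite [leLHS]/Num.norm /= mx_normrE; apply/bigmax_leP; split; first exact: enorm_ge0.
by move=> [i j] _ /=; rewrite ord1 ler_coord_enorm.
Qed.

Lemma ler_coord_norm x i : `|x ord0 i| <= `|x|.
Proof.
by rewrite [leRHS]/Num.norm /= mx_normrE; apply: (le_bigmax _ _ (ord0, i)).
Qed.

Lemma enorm_le_coord x c : (forall i, `|x ord0 i| <= c) -> 0 <= c ->
  enorm x <= q%:R * c.
Proof.
move=> xc c0; rewrite -(@ler_pXn2r _ 2)// ?nnegrE ?mulr_ge0 ?enorm_ge0//.
rewrite enorm_sqr (@le_trans _ _ (\sum_(i < q) c ^+ 2))//.
  by apply: ler_sum => i _; rewrite -expr2 -real_normK ?num_real// ler_pXn2r ?nnegrE.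
rewrite sumr_const card_ord exprMn -[leLHS]mulr_natl ler_wpM2r ?sqr_ge0//.
by rewrite -natrX ler_nat; case: (q) => // n; rewrite -[leqLHS]mul1n leq_mul.
Qed.

Lemma enorm_le_norm x : enorm x <= q%:R * `|x|.
Proof. by apply: enorm_le_coord => // i; exact: ler_coord_norm. Qed.

(** The balls of the library on ['rV] are cubes. *)
Definition eball x c : set 'rV[R]_q := [set y | enorm (y - x) < c].

Lemma eball_center x c : 0 < c -> eball x c x.
Proof. by move=> c0; rewrite /eball /= subrr enorm0. Qed.

Lemma lipschitz_continuous (V : normedModType R) (h : 'rV[R]_q -> V) c :
  (forall x y, `|h x - h y| <= c * enorm (x - y)) -> continuous h.
Proof.
move=> hl x; have c1 : 0 < `|c| * q%:R + 1 by rewrite ltr_wpDl// mulr_ge0.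
move=> A /nbhs_ballP[e /= e0 eA]; apply/nbhs_ballP.
exists (e / (`|c| * q%:R + 1)) => /=.
  by rewrite divr_gt0.
move=> y; rewrite -ball_normE /= ltr_pdivlMr// => xy; apply: eA; rewrite -ball_normE /=.
rewrite (le_lt_trans (hl _ _))// (le_lt_trans _ xy)// mulrDr mulr1 mulrC.
rewrite ler_wpDr// (le_trans (ler_wpM2l (enorm_ge0 _) (ler_norm c)))//.
by rewrite mulrC mulrCA ler_wpM2l// mulrC enorm_le_norm.
Qed.

Lemma eball_open x c : open (eball x c).
Proof.
rewrite (_ : eball x c = (fun y => enorm (y - x)) @^-1` [set t | t < c])//.
apply: open_comp; last exact: open_lt.
move=> y _; apply: (@lipschitz_continuous _ _ 1) => {}y z; rewrite mul1r.
by rewrite (le_trans (ler_enorm_dist _ _))// opprB addrA subrK.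
Qed.

Lemma open_eball (U : set 'rV[R]_q) x : open U -> U x ->
  exists2 e, 0 < e & eball x e `<=` U.
Proof.
move=> oU Ux; have /nbhs_ballP[e /= e0 eU] : nbhs x U by rewrite nbhsE; exists U.
exists e => // y; rewrite /eball /= => xy; apply: eU.
by rewrite -ball_normE /= distrC (le_lt_trans (ler_norm_enorm _)).
Qed.

Lemma bounded_enorm (U : set 'rV[R]_q) : bounded_set U ->
  exists2 c, 0 < c & forall x, U x -> enorm x <= c.
Proof.
move=> [M [_ MU]]; exists (q%:R * (`|M| + 1) + 1); first by rewrite ltr_wpDl// mulr_ge0.
move=> x /(MU (`|M| + 1)); rewrite (le_lt_trans (ler_norm M)) ?ltrDl// => /(_ isT) /= xM.
by rewrite ler_wpDr// (le_trans (enorm_le_norm _))// ler_wpM2l.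
Qed.

Lemma enorm_bounded (U : set 'rV[R]_q) c :
  (forall x, U x -> enorm x <= c) -> bounded_set U.
Proof.
move=> cU; exists c; split; first exact: num_real.
by move=> M cM x /cU xc /=; rewrite (le_trans (ler_norm_enorm _))// (le_trans xc)// ltW.
Qed.

(** Compactness, as near-covering, makes the local radii uniform. *)
Lemma compact_open_margin (C O : set 'rV[R]_q) : compact C -> open O -> C `<=` O ->
  exists2 e, 0 < e & forall x, C x -> eball x e `<=` O.
Proof.
move=> /compact_near_coveringP cC oO CO.
have : \forall e \near (0:R)^'+, C `<=` [set x | eball x e `<=` O].
  apply: (cC R (0^'+)) => x Cx.
  have [e e0 eO] := open_eball oO (CO _ Cx).
  have e2 : 0 < e / 2 by rewrite divr_gt0.
  exists (eball x (e / 2), [set t | t < e / 2]) => /=.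
    split; first by apply: open_nbhs_nbhs; split; [exact: eball_open|exact: eball_center].
    exact: nbhs_right_lt.
  move=> [y t] /= [xy te] z zy; apply: eO; rewrite /eball /=.
  rewrite (le_lt_trans (enorm_triangle y _ _))// (@lt_trans _ _ (t + e/2)) ?ltrD//.
  lra.
move=> near0.
have [e [e0 eC]] : exists e : R, 0 < e /\ C `<=` [set x | eball x e `<=` O].
  near (0:R)^'+ => e; exists e; split; first by near: e; exact: nbhs_right_gt.
  by near: e.
by exists e.
Unshelve. all: by end_near. Qed.

End euclid.

(** Bounded packing: at scale [c], points that are [rho * c]-separated and stay
    within [M * c] of a common point fall into distinct cells of a cubic grid. *)
Lemma packing (R : realType) (q : nat) (rho M : R) : 0 < rho -> 0 < M ->
  exists K : nat, forall (T : eqType) (s : seq T) (y : T -> 'rV[R]_q) z (c : R),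
    0 < c -> uniq s ->
    (forall i, i \in s -> enorm (y i - z) <= M * c) ->
    (forall i j, i \in s -> j \in s -> i != j -> rho * c <= enorm (y i - y j)) ->
    (size s <= K)%N.
Proof.
move=> rho0 M0.
pose h := rho / (2 * q.+1%:R); have h0 : 0 < h by rewrite divr_gt0// mulr_gt0.
pose K0 := Num.truncn (2 * M / h).
exists #|{ffun 'I_q -> 'I_K0.+1}| => T s y z c c0 us sM sep.
pose g i k := (y i ord0 k - z ord0 k + M * c) / (h * c).
have hc : 0 < h * c by rewrite mulr_gt0.
have g0 i k : i \in s -> 0 <= g i k <= 2 * M / h.
  move=> /sM iM; have := le_trans (ler_coord_enorm _ k) iM.
  rewrite !mxE ler_norml => /andP[h1 h2]; rewrite /g divr_ge0/= ?(ltW hc)//; last lra.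
  rewrite ler_pdivrMr// (_ : 2 * M / h * (h * c) = 2 * M * c); first by lra.
  by rewrite mulrA divfK// gt_eqF.
pose F i : {ffun 'I_q -> 'I_K0.+1} := [ffun k => inord (Num.truncn (g i k))].
have tr i k : i \in s -> (F i k : nat) = Num.truncn (g i k).
  move=> /(g0 _ k)/andP[a b]; rewrite ffunE inordK// ltnS le_truncn//.
have Finj : {in s &, injective F}.
  move=> i j si sj Fij; apply/eqP; apply: contraT => ij.
  have := sep _ _ si sj ij; rewrite leNgt => /negP[].
  apply: (@le_lt_trans _ _ (q%:R * (h * c))); last first.
    rewrite mulrA ltr_pM2r// /h mulrCA gtr_pMr// ltr_pdivrMr ?mulr_gt0//.
    by rewrite mul1r -natrM ltr_nat mul2n -addnn addnS ltnS leq_addl.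
  apply: enorm_le_coord; last exact: ltW.
  move=> k; rewrite !mxE.
  have e : Num.truncn (g i k) = Num.truncn (g j k) by rewrite -!tr// Fij.
  have /andP[a1 a2] := g0 _ k si; have /andP[b1 b2] := g0 _ k sj.
  have /andP[c1 c2] := truncn_itv a1; have /andP[d1 d2] := truncn_itv b1.
  have : `|g i k - g j k| <= 1.
    rewrite ler_norml; rewrite e in c1 c2.
    by rewrite -natr1 in c2 d2; apply/andP; split; lra.
  rewrite (_ : g i k - g j k = (y i ord0 k - y j ord0 k) / (h * c)); last first.
    by rewrite /g -mulrBl; congr (_ / _); ring.
  by rewrite normrM normfV (gtr0_norm hc) ler_pdivrMr// mul1r.
rewrite -(size_map F) -(card_uniqP _) ?max_card//.
by rewrite map_inj_in_uniq.
Qed.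

(** * Similitudes and words *)

Section similitude.
Context (R : realType) (q : nat).
Implicit Types (f : 'rV[R]_q -> 'rV[R]_q) (x y : 'rV[R]_q) (s : R).

(** An isometry fixing the origin preserves dot products, hence is
    right multiplication by an orthogonal matrix. *)
Lemma similitude_surj f s : contractive_similitude f s ->
  forall y, exists x, f x = y.
Proof.
move=> [/andP[s0 _] fs].
pose h x := s^-1 *: (f x - f 0).
have hB x y : enorm (h x - h y) = enorm (x - y).
  rewrite /h -scalerBr opprB addrA subrK enormZ fs gtr0_norm ?invr_gt0//.
  by rewrite mulKf// gt_eqF.
have h0 : h 0 = 0 by rewrite /h subrr scaler0.
have hN x : enorm (h x) = enorm x by have := hB x 0; rewrite h0 !subr0.
have hD x y : dotp (h x) (h y) = dotp x y.
  have E u v : dotp u v = (enorm u ^+ 2 + enorm v ^+ 2 - enorm (u - v) ^+ 2) / 2.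
    rewrite !enorm_sqr dotpBl ![dotp _ (u - v)]dotpC !dotpBl (dotpC v u).
    by field.
  by rewrite E [RHS]E !hN hB.
have de x j : dotp x (delta_mx ord0 j) = x ord0 j.
  rewrite /dotp (bigD1 j)//= mxE !eqxx mulr1 big1 ?addr0// => i ij.
  by rewrite mxE (negbTE ij) andbF mulr0.
pose M : 'M[R]_q := \matrix_(i, j) h (delta_mx ord0 i) ord0 j.
have hM x : h x *m M^T = x.
  apply/rowP => j; rewrite -[RHS]de -hD mxE; apply: eq_bigr => k _.
  by rewrite !mxE.
have MM : M *m M^T = 1%:M.
  apply/matrixP => i j; rewrite !mxE.
  rewrite (_ : \sum_j0 _ = dotp (h (delta_mx ord0 i)) (h (delta_mx ord0 j))); last first.
    by apply: eq_bigr => k _; rewrite !mxE.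
  by rewrite hD de mxE eqxx eq_sym.
move=> y; exists ((s^-1 *: (y - f 0)) *m M^T).
set x := _ *m M^T.
have : h x = s^-1 *: (y - f 0).
  by rewrite -[LHS]mulmx1 -(mulmx1C MM) mulmxA hM -mulmxA (mulmx1C MM) mulmx1.
move=> /(congr1 (fun z => s *: z)); rewrite /h !scalerA mulfV ?gt_eqF// !scale1r.
by move=> /(congr1 (fun z => z + f 0)); rewrite !subrK.
Qed.

Lemma similitude_continuous f s : contractive_similitude f s -> continuous f.
Proof.
move=> [_ fs]; apply: (@lipschitz_continuous _ _ _ _ s) => x y.
by rewrite (le_trans (ler_norm_enorm _))// fs.
Qed.

Lemma similitude_closed f s (A : set 'rV[R]_q) : contractive_similitude f s ->
  bounded_set A -> closed A -> closed (f @` A).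
Proof.
move=> cf bA cA; apply: compact_closed; first exact: norm_hausdorff.
apply: continuous_compact; last exact: bounded_closed_compact.
by apply: continuous_subspaceT; exact: similitude_continuous cf.
Qed.

(** The image of a ball is a ball, by surjectivity, so it keeps the other image
    at a distance. *)
Lemma disjoint_image_dist f g s (U : set 'rV[R]_q) x y e :
  contractive_similitude f s -> (f @` U) `&` (g @` U) = set0 ->
  eball x e `<=` U -> U y -> s * e <= enorm (f x - g y).
Proof.
move=> cf fg xU Uy; rewrite leNgt; apply/negP => lt.
have [z fz] := similitude_surj cf (g y).
have [/andP[s0 _] fs] := cf.
suff : ((f @` U) `&` (g @` U)) (g y) by rewrite fg.
split; last by exists y.
exists z => //; apply: xU; rewrite /eball /=.
by rewrite -fz fs ltr_pM2l// enormC in lt.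
Qed.

End similitude.

(** A word over a finite alphabet acts by [foldr f], first letter outermost. *)
Definition wprod (R : realType) (n : nat) (c : 'I_n -> R) (w : seq 'I_n) : R :=
  \prod_(i <- w) c i.

Fixpoint incomparable (n : nat) (u v : seq 'I_n) : bool :=
  match u, v with
  | i :: u', j :: v' => (i != j) || incomparable u' v'
  | _, _ => false
  end.

Section words.
Context (R : realType) (n : nat).
Implicit Types (c : 'I_n -> R) (u v w : seq 'I_n).

Lemma wprod0 c : wprod c [::] = 1. Proof. by rewrite /wprod big_nil. Qed.

Lemma wprod_cons c i w : wprod c (i :: w) = c i * wprod c w.
Proof. by rewrite /wprod big_cons. Qed.

Lemma wprod_cat c u v : wprod c (u ++ v) = wprod c u * wprod c v.
Proof. by rewrite /wprod big_cat. Qed.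

Lemma wprod_gt0 c w : (forall i, 0 < c i) -> 0 < wprod c w.
Proof. by move=> c0; apply: prodr_gt0. Qed.

Lemma wprod_le1 c w : (forall i, 0 < c i < 1) -> wprod c w <= 1.
Proof.
by move=> c1; apply: prodr_ile1 => i _; have /andP[/ltW-> /ltW->] := c1 i.
Qed.

Lemma wprod_lt1 c w : (forall i, 0 < c i < 1) -> w != [::] -> wprod c w < 1.
Proof.
case: w => // i w c1 _; rewrite wprod_cons; have /andP[i0 i1] := c1 i.
by rewrite (le_lt_trans _ i1)// ler_piMr ?(ltW i0)// wprod_le1.
Qed.

Lemma wprodM c (d : 'I_n -> R) w :
  wprod (fun i => c i * d i) w = wprod c w * wprod d w.
Proof. by rewrite /wprod big_split. Qed.

Lemma wprod_powR c r w : (forall i, 0 < c i) ->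
  wprod (fun i => c i `^ r) w = wprod c w `^ r.
Proof.
move=> c0; elim: w => [|i w IH]; first by rewrite !wprod0 powR1.
by rewrite !wprod_cons IH powRM ?ltW ?wprod_gt0.
Qed.

Lemma incomparableC u v : incomparable u v = incomparable v u.
Proof. by elim: u v => [|i u IH] [|j v]//=; rewrite eq_sym IH. Qed.

Lemma incomparable_irr u : incomparable u u = false.
Proof. by elim: u => //= i u ->; rewrite eqxx. Qed.

Lemma incomparable_cat2l w u v : incomparable (w ++ u) (w ++ v) = incomparable u v.
Proof. by elim: w => //= i w ->; rewrite eqxx. Qed.

Lemma incomparable_cat u v u' v' : incomparable u v -> incomparable (u ++ u') (v ++ v').
Proof.
by elim: u v => [|i u IH] [|j v]//= /orP[->//|/IH->]; rewrite orbT.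
Qed.

Lemma incomparableP u v : incomparable u v ->
  exists w i j u' v', [/\ i != j, u = w ++ i :: u' & v = w ++ j :: v'].
Proof.
elim: u v => [|i u IH] [|j v]//=.
have [<-{j}/=|ij _] := eqVneq i j; last by exists [::], i, j, u, v.
by move=> /IH[w [k [l [u' [v' [kl -> ->]]]]]]; exists (i :: w), k, l, u', v'.
Qed.

Lemma comparable_words u v : ~~ incomparable u v ->
  (exists w, v = u ++ w) \/ (exists w, u = v ++ w).
Proof.
elim: u v => [|i u IH] [|j v]//=; try by [left; eexists|right; eexists].
by have [->|//] := eqVneq i j; move=> /= /IH[[w ->]|[w ->]]; [left|right]; exists w.
Qed.

End words.

Lemma similitude_word (R : realType) (q n : nat) (f : 'I_n -> 'rV[R]_q -> 'rV[R]_q) s :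
  (forall i, contractive_similitude (f i) (s i)) ->
  forall w x y, enorm (foldr f x w - foldr f y w) = wprod s w * enorm (x - y).
Proof.
move=> fs; elim=> [|i w IH] x y /=; first by rewrite wprod0 mul1r.
by rewrite (fs i).2 IH wprod_cons mulrA.
Qed.

Lemma foldr_invariant (n : nat) (T : Type) (f : 'I_n -> T -> T) (A : set T) :
  (forall i x, A x -> A (f i x)) -> forall w x, A x -> A (foldr f x w).
Proof. by move=> fA; elim=> //= i w IH x /IH/fA. Qed.

(** * Strong separation from the open set condition *)

Lemma finite_lower_bound (R : realType) (n : nat) (c : 'I_n -> R) :
  (forall i, 0 < c i) -> exists2 m, 0 < m <= 1 & forall i, m <= c i.
Proof.
move=> c0; exists (\big[Order.min/1]_i c i); last by move=> i; exact: bigmin_le_cond.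
rewrite bigmin_le_id andbT; elim/big_ind: _ => // x y x0 y0.
by rewrite lt_min x0.
Qed.

Lemma cat_eq_cat (T : Type) (u w p t : seq T) : u ++ w = p ++ t ->
  (exists p', p = u ++ p' /\ w = p' ++ t) \/
  (exists t', t' <> [::] /\ u = p ++ t').
Proof.
elim: u p => [|i u IH] [|j p] /=; first by left; exists [::].
- by move=> ->; left; exists (j :: p).
- by move=> _; right; exists (i :: u).
- by case=> <- /IH[[p' [-> ->]]|[t' [t0 ->]]]; [left; exists p'|right; exists t'].
Qed.

Section separation.
Context (R : realType) (q n : nat).
Context (g : 'I_n -> 'rV[R]_q -> 'rV[R]_q) (c : 'I_n -> R).
Hypothesis cg : forall i, contractive_similitude (g i) (c i).

Let c01 i : 0 < c i < 1. Proof. exact: (cg i).1. Qed.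
Let c_gt0 i : 0 < c i. Proof. by have /andP[] := c01 i. Qed.
Let wc_gt0 w : 0 < wprod c w. Proof. exact: wprod_gt0. Qed.

Lemma word_ball (U : set 'rV[R]_q) x e w :
  (forall i y, U y -> U (g i y)) -> eball x e `<=` U ->
  eball (foldr g x w) (wprod c w * e) `<=` U.
Proof.
move=> gU xU y; have [z <-] : exists z, foldr g z w = y.
  elim: w y => [|i w IH] y /=; first by exists y.
  have [y' <-] := similitude_surj (cg i) y.
  by have [z <-] := IH y'; exists z.
rewrite /eball /= (similitude_word cg) ltr_pM2l// => zx.
exact: foldr_invariant (xU _ zx).
Qed.

Lemma OSC_invariant (U : set 'rV[R]_q) i x : OSC_set g U -> U x -> U (g i x).
Proof. by case=> _ _ _ _ gU Ux; apply: gU; exists i => //; exists x. Qed.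

(** After their common prefix the words enter disjoint images of [U]. *)
Lemma OSC_word_dist (U : set 'rV[R]_q) x y e u v : OSC_set g U ->
  eball x e `<=` U -> U y -> incomparable u v ->
  wprod c u * e <= enorm (foldr g x u - foldr g y v).
Proof.
move=> oU xU Uy /incomparableP[w [i [j [u' [v' [ij -> ->]]]]]].
rewrite !foldr_cat (similitude_word cg) wprod_cat -mulrA ler_pM2l//=.
rewrite wprod_cons -mulrA.
have invU i' z : U z -> U (g i' z) by exact: OSC_invariant.
apply: (disjoint_image_dist (cg i) (U := U)).
- by case: oU => _ _ _ d _; exact: d.
- exact: word_ball.
- exact: foldr_invariant.
Qed.

Lemma wprod_cut w h : wprod c w <= h -> exists u v, [/\ w = u ++ v, wprod c u <= h &
  forall u' v', u = u' ++ v' -> v' <> [::] -> h < wprod c u'].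
Proof.
elim/last_ind: w => [|w i IH] hw.
  by exists [::], [::]; split=> // -[|? ?] [|? ?].
have [wh|wh] := leP (wprod c w) h.
  have [u [v [-> uh up]]] := IH wh.
  by exists u, (rcons v i); rewrite rcons_cat.
exists (rcons w i), [::]; split; rewrite ?cats0// => u' v'.
case/lastP: v' => // v' j; rewrite -rcons_cat => /rcons_inj[wE _] _.
rewrite (lt_le_trans wh)// wE wprod_cat ler_piMr ?(ltW (wc_gt0 _))//.
exact: wprod_le1.
Qed.

Variables (A : set 'rV[R]_q) (a : 'rV[R]_q).

(** [w] is a piece of the size of [k] that comes close to the piece [k]: one of
    the neighbours that are counted in Schief's argument. *)
Let neighbour k w := [/\ wprod c w <= wprod c k,
  (forall u v, w = u ++ v -> v <> [::] -> wprod c k < wprod c u) &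
  exists2 b, A b & enorm (foldr g b w - foldr g a k) < wprod c k].

(** The similitude of the prefix [u] scales [k] and [w] alike. *)
Let neighbour_cat u k w : neighbour k w -> neighbour (u ++ k) (u ++ w).
Proof.
move=> [wk wp [b Ab bk]]; split.
- by rewrite !wprod_cat ler_pM2l.
- move=> p t /cat_eq_cat[[p' [-> /wp h /h]]|[t' [t0 ->]] _].
    by rewrite !wprod_cat ltr_pM2l.
  rewrite 2!wprod_cat -mulrA gtr_pMr//.
  rewrite (@le_lt_trans _ _ (wprod c t'))//; last by apply: wprod_lt1 => //; apply/eqP.
  by rewrite ler_piMr ?(ltW (wc_gt0 _))// wprod_le1.
- by exists b => //; rewrite !foldr_cat (similitude_word cg) wprod_cat ltr_pM2l.
Qed.

(** Neighbours of [k] are pairwise incomparable words with ratios of the order of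
    [wprod c k], so the images of one point of the open set are packed. *)
Let neighbour_bounded : OSC g -> (exists M, forall x, A x -> enorm x <= M) ->
  exists K : nat, forall k L, uniq L -> (forall w, w \in L -> neighbour k w) ->
  (size L <= K)%N.
Proof.
move=> [U oU] [M AM]; have [[x Ux] _ openU _ _] := oU.
have [e e0 xU] := open_eball openU Ux.
have [m /andP[m0 m1] mc] := finite_lower_bound c_gt0.
pose M' := enorm x + `|M| + 1.
have M'0 : 0 < M' by rewrite ltr_wpDl// addr_ge0 ?enorm_ge0.
have [K HK] := @packing R q (e * m) M' (mulr_gt0 e0 m0) M'0.
exists K => k L uL Lk; apply: (HK _ L (foldr g x) (foldr g a k) (wprod c k)) => //.
- move=> w /Lk[wk _ [b Ab bk]].
  rewrite (le_trans (enorm_triangle (foldr g b w) _ _))// mulrDl mul1r lerD ?(ltW bk)//.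
  rewrite (similitude_word cg) mulrC ler_pM ?enorm_ge0 ?(ltW (wc_gt0 _))//.
  rewrite (le_trans (ler_enormD _ _))// enormN lerD2l.
  by rewrite (le_trans (AM _ Ab))// ler_norm.
- have low w : w \in L -> m * wprod c k <= wprod c w.
    move=> /Lk[_ wp _]; elim/last_ind: w wp => [|w i _] wp.
      by rewrite wprod0 mulr_ile1 ?(ltW m0) ?(ltW (wc_gt0 _)) ?wprod_le1.
    have wk : wprod c k < wprod c w by apply: (wp w [:: i]); rewrite ?cats1.
    rewrite -cats1 wprod_cat wprod_cons wprod0 mulr1 [leRHS]mulrC.
    by rewrite ler_pM ?mc// ?(ltW m0) ?(ltW (wc_gt0 _)) ?(ltW wk).
  move=> u v uL' vL uv; have uv_inc : incomparable u v.
    apply: contraT => /comparable_words; have [u1 u2 _] := Lk _ uL'.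
    have [v1 v2 _] := Lk _ vL.
    move=> [[w vE]|[w uE]].
    + have w0 : w <> [::] by move=> w0; rewrite vE w0 cats0 eqxx in uv.
      by have := v2 _ _ vE w0; rewrite ltNge u1.
    + have w0 : w <> [::] by move=> w0; rewrite uE w0 cats0 eqxx in uv.
      by have := u2 _ _ uE w0; rewrite ltNge v1.
  apply: le_trans (OSC_word_dist oU xU Ux uv_inc).
  by rewrite -mulrA mulrC ler_pM2r// low.
Qed.

(** Schief's theorem in metric form. If no piece has more neighbours than [k], the
    neighbours of [u ++ k] are exactly the [u ++ w] with [w] a neighbour of [k], so
    a piece whose word starts differently cannot come close to [u ++ k]. *)
Lemma strong_separation : OSC g -> A a ->
    (exists M, forall x, A x -> enorm x <= M) ->
    (forall i x, A x -> A (g i x)) ->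
  exists x d, [/\ A x, 0 < d & forall u v, incomparable u v ->
    d * Num.max (wprod c u) (wprod c v) <= enorm (foldr g x u - foldr g x v)].
Proof.
move=> osc Aa bA gA.
have [K HK] := neighbour_bounded osc bA.
pose P m := `[< exists k L, [/\ uniq L, (forall w, w \in L -> neighbour k w) &
                              size L = m] >].
have exP : exists m, P m by exists 0%N; apply/asboolP; exists [::], [::].
have bP m : P m -> (m <= K)%N.
  by move=> /asboolP[k [L [uL Lk <-]]]; exact: HK uL Lk.
case: (ex_maxnP exP bP) => _ /asboolP[k [L [uL Lk <-]]] maxL.
exists (foldr g a k), (wprod c k); split => //; first exact: foldr_invariant.
have main u v : incomparable u v -> wprod c v <= wprod c u ->
    wprod c k * wprod c u <= enorm (foldr g (foldr g a k) u - foldr g (foldr g a k) v).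
  move=> /incomparableP[w [i [j [u' [v' [ij -> ->]]]]]].
  rewrite !foldr_cat (similitude_word cg) !wprod_cat ler_pM2l// => vu.
  rewrite mulrCA ler_pM2l// leNgt; apply/negP.
  set iu := i :: u'; set jv := j :: v'; rewrite -!foldr_cat mulrC -wprod_cat => lt.
  have vuk : wprod c (jv ++ k) <= wprod c (iu ++ k) by rewrite !wprod_cat ler_pM2r.
  (* cut the word of the close point at the size of [iu ++ k] *)
  have [p [t [vkE ph pp]]] := wprod_cut vuk.
  have np : neighbour (iu ++ k) p.
    split=> //; exists (foldr g a t); first exact: foldr_invariant.
    by rewrite -foldr_cat -vkE enormC.
  (* [p] starts with [j], so it is a new neighbour of [iu ++ k] *)
  suff /maxL : P (size L).+1 by rewrite ltnn.
  apply/asboolP; exists (iu ++ k), (p :: map (cat iu) L); split.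
  - rewrite /= map_inj_uniq ?uL ?andbT; last first.
      by move=> x y [] /(congr1 (drop (size u'))); rewrite !drop_size_cat.
    apply/mapP => -[w' _ pE]; move: vkE; rewrite pE /= => -[ji _].
    by rewrite ji eqxx in ij.
  - by move=> w'; rewrite inE => /predU1P[->//|/mapP[w'' /Lk + ->]]; exact: neighbour_cat.
  - by rewrite /= size_map.
move=> u v uv; have [vu|uv'] := leP (wprod c v) (wprod c u).
  exact: main.
by rewrite enormC main ?ltW// incomparableC.
Qed.

End separation.

(** * Measure-theoretic preliminaries *)

Section measure_rV.
Context (R : realType) (q : nat).
Local Notation rV := 'rV[R]_q.
Implicit Types (P Q : probability (borel_rV R q) R).

Lemma open_measurable_rV (A : set rV) : open A -> measurable (A : set (borel_rV R q)).
Proof. by move=> oA; exact: sub_sigma_algebra. Qed.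

Lemma measurable_eball (x : rV) c : measurable (eball x c : set (borel_rV R q)).
Proof. by apply: open_measurable_rV; exact: eball_open. Qed.

Lemma continuous_measurable_rV (h : rV -> R) : continuous h ->
  measurable_fun [set: borel_rV R q] h.
Proof.
move=> /continuousP ch; apply: (measurability _ (measurable_realfun.RGenOpens.measurableE R)).
move=> _ [_ [a [b ->] <-]]; rewrite setTI.
by apply: open_measurable_rV; apply: ch; exact: interval_open.
Qed.

Lemma continuous_measurable_rV2 (h : rV -> rV) : continuous h ->
  measurable_fun [set: borel_rV R q] (h : borel_rV R q -> borel_rV R q).
Proof.
move=> /continuousP ch; apply: (measurability _ (erefl : @measurable _ (borel_rV R q) = _)).
move=> _ [B oB <-]; rewrite setTI.
by apply: open_measurable_rV; exact: ch.
Qed.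

Lemma integral_mixture n P (Q : 'I_n -> probability (borel_rV R q) R)
    (h : 'I_n -> rV -> rV) (w : 'I_n -> R) (phi : borel_rV R q -> \bar R) :
  (forall i, 0 <= w i) -> (forall i, continuous (h i)) ->
  (forall A : set (borel_rV R q), measurable A ->
     P A = (\sum_(i < n) (w i)%:E * Q i (h i @^-1` A))%E) ->
  (forall x, (0 <= phi x)%E) -> measurable_fun [set: borel_rV R q] phi ->
  (\int[P]_x phi x = \sum_(i < n) (w i)%:E * \int[Q i]_x phi (h i x))%E.
Proof.
move=> w0 ch PE phi0 mphi.
have mh i := continuous_measurable_rV2 (ch i).
(* the pushforward is a measure by [mh], which [pose] leaves as an argument *)
pose push i : {measure set (borel_rV R q) -> \bar R} :=
  pushforward (Q i) (h i : borel_rV R q -> borel_rV R q).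
pose m (k : nat) : {measure set (borel_rV R q) -> \bar R} :=
  if insub k is Some i then mscale (NngNum (w0 i)) (push mh i) else mzero.
have mE (i : 'I_n) : m i = mscale (NngNum (w0 i)) (push mh i) by rewrite /m valK.
rewrite (eq_measure_integral (msum m n)); last first.
  move=> A mA _; apply: (eq_trans (PE _ mA)); apply: eq_bigr => i _.
  by rewrite mE.
rewrite ge0_integral_measure_sum//; apply: eq_bigr => i _.
by rewrite mE ge0_integral_mscale//= ge0_integral_pushforward.
Qed.

Definition outside (c : R) : set rV := [set x | c < enorm x].

Lemma enorm_continuous : continuous (@enorm R q).
Proof.
by apply: (@lipschitz_continuous _ _ _ _ 1) => x y; rewrite mul1r ler_enorm_dist.
Qed.

Lemma measurable_outside c : measurable (outside c : set (borel_rV R q)).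
Proof.
apply: open_measurable_rV; rewrite (_ : outside c = (@enorm R q) @^-1` [set t | c < t])//.
by apply: open_comp; [move=> x _; exact: enorm_continuous|exact: open_gt].
Qed.

Lemma outside_vanish P c : (forall k : nat, (P (outside c) <= P (outside (c + k%:R)))%E) ->
  P (outside c) = 0%E.
Proof.
move=> Pc; apply/eqP; rewrite eq_le measure_ge0 andbT.
have F0 : \bigcap_k outside (c + k%:R) = set0.
  rewrite -subset0 => x xk; have := xk (Num.truncn (enorm x - c)).+1 I.
  rewrite /outside /= ltNge => /negP; apply.
  by rewrite -lerBlDl ltW// truncnS_gt.
have : P (outside (c + k%:R)) @[k --> \oo] --> P (\bigcap_k outside (c + k%:R)).
  apply: nonincreasing_cvg_mu.
  - by rewrite (le_lt_trans (probability_le1 _ _)) ?ltry//; exact: measurable_outside.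
  - by move=> k; exact: measurable_outside.
  - by apply: bigcapT_measurable => k; exact: measurable_outside.
  - move=> a b ab; apply/subsetPset => x; rewrite /outside /=.
    by apply: le_lt_trans; rewrite lerD2l ler_nat.
rewrite F0 measure0 => Pcvg; rewrite -(cvg_lim _ Pcvg)//.
apply: lime_ge; first by apply/cvg_ex; exists 0%E.
exact: nearW.
Qed.

(** For large [d] every map pulls [outside d] back into [outside (d + 1)], so the
    mass of [outside d] does not decrease with [d], whereas it tends to [0]. *)
Lemma concentrated P n (g : 'I_n -> rV -> rV) c (w : 'I_n -> R) c1 :
  (forall i, contractive_similitude (g i) (c i)) ->
  (forall i, 0 <= w i) -> \sum_(i < n) w i <= 1 ->
  (forall d, c1 <= d -> (P (outside d) <= \sum_(i < n) (w i)%:E * P (g i @^-1` outside d))%E) ->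
  exists2 d, c1 <= d & P (outside d) = 0%E.
Proof.
move=> cg w0 w1 Pd.
have [m /andP[m0 _] mc] : exists2 m, 0 < m <= 1 & forall i, m <= 1 - c i.
  by apply: finite_lower_bound => i; rewrite subr_gt0; have [/andP[]] := cg i.
pose M := \sum_(i < n) enorm (g i 0).
have M0 : 0 <= M by apply: sumr_ge0 => i _; exact: enorm_ge0.
(* from [d0] on, [M + (1 - m) * (d + 1) <= d] *)
pose d0 := Num.max c1 ((M + 1) / m).
exists d0; first by rewrite le_max lexx.
apply: outside_vanish; elim=> [|k IH]; first by rewrite addr0.
apply: (le_trans IH); set d := d0 + k%:R.
have d0d : d0 <= d by rewrite lerDl.
have d1 : c1 <= d by rewrite (le_trans _ d0d)// le_max lexx.
have d2 : M + 1 <= d * m.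
  by rewrite -ler_pdivrMr// (le_trans _ d0d)// le_max lexx orbT.
apply: (le_trans (Pd _ d1)).
have gd i : g i @^-1` outside d `<=` outside (d + 1).
  move=> x; rewrite /outside /=; apply: contraTT; rewrite -!leNgt => xd.
  have [/andP[ci0 ci1] gi] := cg i.
  have gx := ler_enormD (g i x - g i 0) (g i 0); rewrite subrK gi subr0 in gx.
  have gM : enorm (g i 0) <= M.
    by rewrite /M (bigD1 i)//= lerDl sumr_ge0// => j _; exact: enorm_ge0.
  have cix : c i * enorm x <= c i * (d + 1) by rewrite ler_pM2l.
  have dm : d * m <= d * (1 - c i).
    rewrite ler_wpM2l// -(pmulr_lge0 _ m0); lra.
  by lra.
rewrite (@le_trans _ _ (\sum_(i < n) (w i)%:E * P (outside (d + 1))))%E//.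
  apply: lee_sum => i _; apply: lee_wpmul2l; first by rewrite lee_fin.
  apply: le_measure; rewrite ?inE; [|exact: measurable_outside|exact: gd].
  rewrite -[_ @^-1` _]setTI; apply: (continuous_measurable_rV2 (similitude_continuous (cg i))) => //.
  exact: measurable_outside.
rewrite -ge0_sume_distrl; last by move=> i _; rewrite lee_fin.
rewrite sumEFin -natr1 addrA -[leRHS]mul1e; apply: lee_wpmul2r => //.
Qed.

(** Otherwise finitely many null open sets would cover the compact ball that
    carries [P]. *)
Lemma msupport_neq0 P c : P (outside c) = 0%E -> msupport P !=set0.
Proof.
move=> Pc; apply: contrapT => /set0P/negP; rewrite negbK => /eqP C0.
have /choice[V HV] : forall x, exists V : set rV, [/\ open V, V x & P V = 0%E].
  move=> x; have : ~ msupport P x by rewrite C0.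
  move=> /existsNP[V /not_implyP[oV /not_implyP[Vx PV]]]; exists V; split => //.
  by apply/eqP; rewrite eq_le measure_ge0 andbT leNgt; apply/negP.
pose B : set rV := ~` outside c.
have cB : closed B.
  apply: open_closedC; rewrite (_ : outside c = (@enorm R q) @^-1` [set t | c < t])//.
  by apply: open_comp; [move=> x _; exact: enorm_continuous|exact: open_gt].
have bB : bounded_set B by apply: (@enorm_bounded _ _ _ c) => x /negP; rewrite -leNgt.
have := bounded_closed_compact bB cB; rewrite compact_cover.
move=> /(_ rV B V)[|x Bx|D _].
- by move=> x _; have [] := HV x.
- by exists x => //; have [] := HV x.
rewrite /cover bigcup_fset => BD.
have mV x : measurable (V x : set (borel_rV R q)).
  by apply: open_measurable_rV; have [] := HV x.
have PD (s : seq rV) : measurable (\big[setU/set0]_(x <- s) V x : set (borel_rV R q)) /\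
    P (\big[setU/set0]_(x <- s) V x) = 0%E.
  elim: s => [|x s [ms IH]]; first by rewrite big_nil measure0; split.
  rewrite big_cons; split; first exact: measurableU.
  by rewrite measureU0//; have [] := HV x.
have /eqP := @probability_setT _ _ _ P; rewrite -(setUv (outside c)) => /eqP.
have PB : P (~` outside c) = 0%E.
  apply/eqP; rewrite eq_le measure_ge0 andbT; have [mD <-] := PD (finmap.enum_fset D).
  by apply: le_measure; rewrite ?inE//; apply: measurableC; exact: measurable_outside.
rewrite measureU0//.
- by move=> /(etrans (esym Pc)) [] /esym/eqP; rewrite oner_eq0.
- exact: measurable_outside.
- by apply: measurableC; exact: measurable_outside.
Qed.

Lemma msupport_invariant P n (g : 'I_n -> rV -> rV) c (t : 'I_n -> R) :
  (forall i, contractive_similitude (g i) (c i)) -> (forall i, 0 < t i) ->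
  is_self_similar_measure g t P -> forall i x, msupport P x -> msupport P (g i x).
Proof.
move=> cg t0 PE i x Px V oV Vgx.
rewrite PE; last exact: open_measurable_rV.
apply: (@lt_le_trans _ _ ((t i)%:E * P (g i @^-1` V))%E).
  rewrite mule_gt0 ?lte_fin//; apply: Px => //.
  by apply: open_comp => // y _; exact: (similitude_continuous (cg i)).
by rewrite (bigD1 i)//= leeDl// sume_ge0// => j _; rewrite mule_ge0// lee_fin ltW.
Qed.

End measure_rV.

(** * Upper bounds for the quantization error *)

Section eucl_dist.
Context (R : realType) (q : nat).
Implicit Types (x y : 'rV[R]_q) (alpha : set 'rV[R]_q).

Lemma eucl_dist_le x a alpha : alpha a -> eucl_dist x alpha <= enorm (x - a).
Proof.
move=> xa; apply: ge_inf; last by exists a.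
by exists 0 => _ [b _ <-]; exact: enorm_ge0.
Qed.

Lemma eucl_dist_ge x alpha d : alpha !=set0 ->
  (forall a, alpha a -> d <= enorm (x - a)) -> d <= eucl_dist x alpha.
Proof.
move=> [a aa] H; apply: lb_le_inf; first by exists (enorm (x - a)); exists a.
by move=> _ [b /H + <-].
Qed.

Lemma eucl_dist_ge0 x alpha : alpha !=set0 -> 0 <= eucl_dist x alpha.
Proof. by move=> a0; apply: eucl_dist_ge => // a _; exact: enorm_ge0. Qed.

Lemma eucl_dist_continuous alpha : alpha !=set0 ->
  continuous (fun x => eucl_dist x alpha).
Proof.
move=> a0; have H x y : eucl_dist x alpha - eucl_dist y alpha <= enorm (x - y).
  rewrite lerBlDl -lerBlDr; apply: eucl_dist_ge => // a aa.
  rewrite lerBlDr (le_trans (eucl_dist_le _ aa))// [leRHS]addrC.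
  exact: enorm_triangle.
apply: (@lipschitz_continuous _ _ _ _ 1) => x y; rewrite mul1r ler_norml H andbT.
by rewrite lerNl opprB enormC H.
Qed.

Lemma measurable_eucl_dist_powR alpha r : alpha !=set0 ->
  measurable_fun [set: borel_rV R q] (fun x => (eucl_dist x alpha `^ r)%:E).
Proof.
move=> a0; apply/measurable_EFinP.
apply: (measurableT_comp (measurable_powR r)) => //.
by apply: continuous_measurable_rV; exact: eucl_dist_continuous.
Qed.

End eucl_dist.

Section approximable.
Context (R : realType) (q : nat) (r : R) (r0 : 0 < r).
Local Notation rV := 'rV[R]_q.
Implicit Types (P : probability (borel_rV R q) R).

(** Upper estimates are tracked through explicit finite sets, which can be chosen
    part by part in a mixture, rather than through the infimum. *)
Definition approximable P (n : nat) (e : R) : Prop :=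
  exists alpha : seq rV, [/\ alpha != [::], (size alpha <= n)%N &
    (\int[P]_x (eucl_dist x [set` alpha] `^ r)%:E <= e%:E)%E].

Lemma set_seq_neq0 (s : seq rV) : s != [::] -> [set` s] !=set0.
Proof. by case: s => // a s _; exists a; rewrite /= mem_head. Qed.

Lemma approximable_le P n e e' : e <= e' -> approximable P n e -> approximable P n e'.
Proof.
move=> ee [s [s0 sn se]]; exists s; split => //.
by rewrite (le_trans se)// lee_fin.
Qed.

Lemma approximable_leq P n n' e : (n <= n')%N -> approximable P n e -> approximable P n' e.
Proof. by move=> nn [s [s0 sn se]]; exists s; split => //; exact: leq_trans nn. Qed.

Lemma approximable_quantization_error P n e : 0 <= e -> approximable P n e ->
  (quantization_error P r n `^ r <= e%:E)%E.
Proof.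
move=> e0 [s [s0 sn se]].
have le : (quantization_error P r n <= (e `^ r^-1)%:E)%E.
  apply: ge_ereal_inf.
  exists ((\int[P]_x (eucl_dist x [set` s] `^ r)%:E) `^ r^-1)%E.
    exists [set` s] => //=; split; first exact: set_seq_neq0.
    have [x0 _] := set_seq_neq0 s0.
    apply: (card_le_trans _ (_ : `I_(size s) #<= `I_n)%card); last by rewrite card_le_II.
    apply: (card_le_trans _ (card_image_le (nth x0 s) _)).
    apply: subset_card_le => x /= xs; exists (index x s); last exact: nth_index.
    by rewrite /= index_mem.
  rewrite -poweR_EFin; apply: gt0_ler_poweR => //.
  - by rewrite invr_ge0 ltW.
  - rewrite in_itv /= leey andbT; apply: integral_ge0 => x _.
    by rewrite lee_fin powR_ge0.
  - by rewrite in_itv /= leey lee_fin e0.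
have q0 : (0 <= quantization_error P r n)%E.
  by apply: le_ereal_inf_tmp => _ [alpha _ <-]; exact: poweR_ge0.
apply: (@le_trans _ _ ((e `^ r^-1)%:E `^ r)%E).
  apply: gt0_ler_poweR => //; first exact: ltW.
  - by rewrite in_itv /= leey q0.
  - by rewrite in_itv /= leey lee_fin powR_ge0.
by rewrite poweR_EFin -powRrM mulVf ?gt_eqF// powRr1.
Qed.

Lemma approximable_outside P c : 0 <= c -> P (outside c) = 0%E ->
  approximable P 1 (c `^ r).
Proof.
move=> c0 Pc; exists [:: 0]; split => //.
have s0 : [set` [:: 0 : rV]] !=set0 by exact: set_seq_neq0.
apply: (@le_trans _ _ (\int[P]_x (cst (c `^ r)%:E x))%E).
  apply: ae_ge0_le_integral => //.
  - by move=> x _; rewrite lee_fin powR_ge0.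
  - exact: measurable_eucl_dist_powR.
  - by move=> x _; rewrite lee_fin powR_ge0.
  - exists (outside c); split => //; first exact: measurable_outside.
    move=> x /= /not_implyP[_]; apply: contra_notP => /negP; rewrite -leNgt => xc.
    rewrite lee_fin; apply: ge0_ler_powR; rewrite ?nnegrE ?(ltW r0) ?eucl_dist_ge0//.
    have := @eucl_dist_le _ _ x 0 [set` [:: 0]] (mem_head _ _); rewrite subr0.
    by move=> /le_trans; exact.
rewrite integral_cst// -[leRHS]mule1; apply: lee_wpmul2l; first by rewrite lee_fin powR_ge0.
exact: probability_le1.
Qed.

(** Approximating sets for the parts of a mixture are carried over by the maps;
    their union serves the mixture. *)
Lemma approximable_mixture n P (Q : 'I_n -> probability (borel_rV R q) R)
    (h : 'I_n -> rV -> rV) (s w : 'I_n -> R) (k : 'I_n -> nat) (e : 'I_n -> R) :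
  (0 < n)%N ->
  (forall i, 0 <= w i) -> (forall i, 0 < s i) ->
  (forall i x y, enorm (h i x - h i y) = s i * enorm (x - y)) ->
  (forall A : set (borel_rV R q), measurable A ->
     P A = (\sum_(i < n) (w i)%:E * Q i (h i @^-1` A))%E) ->
  (forall i, approximable (Q i) (k i) (e i)) ->
  approximable P (\sum_(i < n) k i) (\sum_(i < n) w i * s i `^ r * e i).
Proof.
move=> n0 w0 s0 hs PE /choice[al Hal].
have ch i : continuous (h i).
  apply: (@lipschitz_continuous _ _ _ _ (s i)) => x y.
  by rewrite (le_trans (ler_norm_enorm _))// hs.
pose be := flatten [seq map (h i) (al i) | i <- index_enum 'I_n].
have beP i a : a \in al i -> h i a \in be.
  move=> ai; apply/flatten_mapP; exists i; first exact: mem_index_enum.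
  exact: map_f.
have be0 : be != [::].
  have [a ai] := set_seq_neq0 (let: And3 x _ _ := Hal (Ordinal n0) in x).
  by have := beP _ _ ai; case: (be).
exists be; split => //.
  rewrite size_flatten /shape -map_comp sumnE big_map.
  by apply: leq_sum => i _ /=; rewrite size_map; have [] := Hal i.
have sb0 := set_seq_neq0 be0.
rewrite (integral_mixture w0 ch PE); first last.
- exact: measurable_eucl_dist_powR.
- by move=> x; rewrite lee_fin powR_ge0.
rewrite -sumEFin; apply: lee_sum => i _.
rewrite -mulrA EFinM; apply: lee_wpmul2l; first by rewrite lee_fin.
have [ai0 _ aie] := Hal i; have si0 := set_seq_neq0 ai0.
apply: (@le_trans _ _ (\int[Q i]_x ((s i `^ r)%:E * (eucl_dist x [set` al i] `^ r)%:E))%E).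
  apply: ge0_le_integral => //.
  - by move=> x _; rewrite lee_fin powR_ge0.
  - apply: (measurableT_comp (measurable_eucl_dist_powR r sb0)).
    exact: continuous_measurable_rV2.
  - by apply: measurable_funeM; exact: measurable_eucl_dist_powR.
  move=> x _; rewrite -EFinM lee_fin -powRM ?eucl_dist_ge0 ?(ltW (s0 _))//.
  apply: ge0_ler_powR; rewrite ?nnegrE ?mulr_ge0 ?eucl_dist_ge0 ?(ltW (s0 _)) ?(ltW r0)//.
  rewrite -ler_pdivrMl//; apply: eucl_dist_ge => // a aa.
  by rewrite ler_pdivrMl// -hs; apply: eucl_dist_le; exact: beP.
rewrite ge0_integralZl_EFin ?powR_ge0//.
- by rewrite EFinM; apply: lee_wpmul2l => //; rewrite lee_fin powR_ge0.
- by move=> x _; rewrite lee_fin powR_ge0.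
- exact: measurable_eucl_dist_powR.
Qed.

End approximable.

(** Induction on a scale: every step multiplies [x] by one of the ratios [b i],
    and stops once [x <= 1]; the words traversed are those whose weight has not
    yet dropped below [1 / x]. *)
Lemma scale_ind (R : realType) (n : nat) (b : 'I_n -> R) (m : R) (T : R -> Prop) :
  (forall i, b i < 1) -> 0 < m -> (forall i, m <= b i) ->
  (forall x, m < x -> x <= 1 -> T x) ->
  (forall x, 1 < x -> (forall i, T (b i * x)) -> T x) ->
  forall x, m < x -> T x.
Proof.
move=> b1 m0 mb T0 T1 x mx.
have [d /andP[d0 d1] db] : exists2 d, 0 < d <= 1 & forall i, d <= 1 - b i.
  by apply: finite_lower_bound => i; rewrite subr_gt0.
suff main (k : nat) y : m < y -> y <= 1 + k%:R * d -> T y.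
  apply: (main (Num.truncn (x / d)).+1) => //.
  rewrite -lerBlDl -ler_pdivrMr// ltW// (le_lt_trans _ (truncnS_gt _))//.
  by rewrite ler_pM2r ?invr_gt0// gerBl.
elim: k y => [|k IH] y my yk; first by apply: T0 => //; rewrite (le_trans yk)// mul0r addr0.
have [y1|y1] := leP y 1; first exact: T0.
apply: T1 => // i; apply: IH.
  by rewrite (le_lt_trans (mb i))// ltr_pMr// (lt_le_trans m0).
have : d * y <= (1 - b i) * y by rewrite ler_wpM2r// (le_trans ler01)// ltW.
have : d * 1 <= d * y by rewrite ler_wpM2l ?ltW.
by move: yk; rewrite -natr1; lra.
Qed.

Lemma sum_powRM (R : realType) n (a : 'I_n -> R) x th : (forall i, 0 < a i) -> 0 <= x ->
  \sum_(i < n) (a i * x) `^ th = (\sum_(i < n) a i `^ th) * x `^ th.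
Proof.
by move=> a0 x0; rewrite mulr_suml; apply: eq_bigr => i _; rewrite powRM// ltW.
Qed.

Lemma powR_lt1 (R : realType) (a th : R) : 0 <= a < 1 -> 0 < th -> a `^ th < 1.
Proof.
by move=> /andP[a0 a1] th0; have := gt0_ltr_powR th0 a0 ler01 a1; rewrite powR1.
Qed.

Lemma weight_lt1 (R : realType) (t c r : R) : 0 < r -> 0 < t <= 1 -> 0 < c < 1 ->
  0 < t * c `^ r < 1.
Proof.
move=> r0 /andP[t0 t1] /andP[c0 c1]; rewrite mulr_gt0 ?powR_gt0//=.
by rewrite (le_lt_trans _ (powR_lt1 _ r0 : c `^ r < 1)) ?(ltW c0)// ler_piMl ?powR_ge0.
Qed.

Lemma cancel_weight (R : realType) (a y x : R) : a != 0 -> a * (y / (a * x)) = y / x.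
Proof. by move=> a0; rewrite invfM mulrCA mulVKf. Qed.

Section upper.
Context (R : realType) (q : nat) (r : R) (r0 : 0 < r).
Local Notation rV := 'rV[R]_q.
Implicit Types (P : probability (borel_rV R q) R).

(** The count obeys [F x = sum_i F (b i * x)], solved by a multiple of [x ^ th];
    the error per point stays [D / x] because [b i] cancels. *)
Lemma self_similar_upper P n (g : 'I_n -> rV -> rV) (c t : 'I_n -> R) D th :
  (0 < n)%N -> 0 < th -> (forall i, contractive_similitude (g i) (c i)) ->
  (forall i, 0 < t i <= 1) -> is_self_similar_measure g t P ->
  \sum_(i < n) (t i * c i `^ r) `^ th = 1 ->
  0 <= D -> approximable r P 1 D ->
  exists2 C, 0 < C & forall x, 1 <= x -> exists k : nat,
    k%:R <= C * x `^ th /\ approximable r P k (D * k%:R / x).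
Proof.
move=> n0 th0 cg t01 PE thE D0 base.
pose b i := t i * c i `^ r.
have c0 i : 0 < c i by have [/andP[]] := cg i.
have b01 i : 0 < b i < 1 by apply: weight_lt1 => //; have [] := cg i.
have b0 i : 0 < b i by have /andP[] := b01 i.
have b1 i : b i < 1 by have /andP[] := b01 i.
have [m /andP[m0 _] mb] := finite_lower_bound b0.
exists (m `^ (- th)); first exact: powR_gt0.
have m1 : m < 1 by rewrite (le_lt_trans (mb (Ordinal n0))).
move=> x /(lt_le_trans m1); move: x.
apply: (scale_ind b1 m0 mb) => [x mx x1|x x1 IH].
  have x0 : 0 < x by exact: lt_trans mx.
  exists 1%N; split.
    rewrite powRN ler_pdivlMl ?powR_gt0// mulr1.
    by apply: ge0_ler_powR; rewrite ?nnegrE ltW.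
  by apply: approximable_le base; rewrite mulr1 ler_pdivlMr// ler_piMr.
have x0 : 0 < x by rewrite (lt_trans ltr01).
have /choice[k Hk] := IH.
exists (\sum_(i < n) k i)%N; split.
  rewrite natr_sum (@le_trans _ _ (\sum_(i < n) m `^ (- th) * (b i * x) `^ th))//.
    by apply: ler_sum => i _; have [] := Hk i.
  by rewrite -mulr_sumr sum_powRM ?(ltW x0)// thE mul1r.
apply: approximable_le (approximable_mixture r0 n0 _ c0 _ PE (fun i => (Hk i).2)).
- rewrite natr_sum mulr_sumr mulr_suml; apply: ler_sum => i _.
  by rewrite -/(b i) cancel_weight// gt_eqF.
- by move=> i; have /andP[/ltW] := t01 i.
- by move=> i; exact: (cg i).2.
Qed.

Section ISM.
Context (N : nat) (f : 'I_N -> rV -> rV) (s : 'I_N -> R) (p : 'I_N.+1 -> R).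
Context (nu mu : probability (borel_rV R q) R).
Hypothesis (N0 : (0 < N)%N) (fs : forall i, contractive_similitude (f i) (s i)).
Hypothesis (p01 : forall i, 0 < p i <= 1) (muE : is_ISM f p nu mu).

Let a (i : 'I_N) := p (lift ord0 i) * s i `^ r.

Lemma ISM_approximable k0 e0 (k : 'I_N -> nat) e :
  approximable r nu k0 e0 -> (forall i, approximable r mu (k i) (e i)) ->
  approximable r mu (k0 + \sum_(i < N) k i) (p ord0 * e0 + \sum_(i < N) a i * e i).
Proof.
move=> nu0 mui.
pose Q (i : 'I_N.+1) := if unlift ord0 i is Some j then mu else nu.
pose h (i : 'I_N.+1) := if unlift ord0 i is Some j then f j else id.
pose c (i : 'I_N.+1) := if unlift ord0 i is Some j then s j else 1.
pose k' (i : 'I_N.+1) := if unlift ord0 i is Some j then k j else k0.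
pose e' (i : 'I_N.+1) := if unlift ord0 i is Some j then e j else e0.
have := @approximable_mixture R q r r0 N.+1 mu Q h c p k' e' isT.
rewrite !big_ord_recl /k' /e' /c unlift_none powR1 mulr1 /a.
under [X in (_ + X)%N]eq_bigr do rewrite liftK.
under [X in _ + X]eq_bigr do rewrite liftK.
apply.
- by move=> i; have /andP[/ltW] := p01 i.
- by move=> i; case: unliftP => [j _|_]//; have [/andP[]] := fs j.
- by rewrite /h => i x y; case: unliftP => [j _|_]; [exact: (fs j).2|rewrite mul1r].
- move=> A mA; rewrite muE// big_ord_recl /Q /h unlift_none; congr (_ + _)%E.
  by apply: eq_bigr => i _; rewrite liftK.
- by move=> i; rewrite /Q; case: unliftP => [j _|_].
Qed.

(** The number of points needed is bounded by [G x = A x^th2 + B x^th1], where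
    [B] solves [B = C + B * kappa] so that [G x] dominates
    [C x^th1 + \sum_i G (a i * x)]. If [kappa > 1] then [B] is negative. *)
Lemma ISM_upper D C th1 th2 :
  0 < th1 -> 0 < th2 -> th1 != th2 ->
  \sum_(i < N) a i `^ th2 = 1 -> 0 <= D -> approximable r mu 1 D -> 0 < C ->
  (forall x, 1 <= x -> exists k : nat,
     k%:R <= C * x `^ th1 /\ approximable r nu k (D * k%:R / x)) ->
  exists2 A, 0 < A & forall x, 1 <= x -> exists k : nat,
     k%:R <= A * x `^ Num.max th1 th2 /\ approximable r mu k (D * k%:R / x).
Proof.
move=> th10 th20 th12 thE D0 base C0 nuC.
have s0 i : 0 < s i by have [/andP[]] := fs i.
have a01 i : 0 < a i < 1 by apply: weight_lt1 => //; have [] := fs i.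
have a0 i : 0 < a i by have /andP[] := a01 i.
have a1 i : a i < 1 by have /andP[] := a01 i.
have [m /andP[m0 _] ma] := finite_lower_bound a0.
have m1 : m < 1 by rewrite (le_lt_trans (ma (Ordinal N0))).
pose kappa := \sum_(i < N) a i `^ th1.
have powlt th th' i : th < th' -> a i `^ th' < a i `^ th.
  move=> lt; have -> : a i `^ th' = a i `^ (th' - th) * a i `^ th.
    by rewrite -powRD ?subrK// (gt_eqF (a0 i)) implybT.
  by rewrite gtr_pMl ?powR_gt0// powR_lt1 ?subr_gt0 ?(ltW (a0 i)) ?a1.
have sumlt th th' : th < th' -> \sum_(i < N) a i `^ th' < \sum_(i < N) a i `^ th.
  move=> lt; apply: ltr_sum => [|i _]; last exact: powlt.
  by apply/hasP; exists (Ordinal N0); rewrite ?mem_index_enum.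
pose B := C / (1 - kappa).
have kappa1 : 1 - kappa != 0.
  rewrite subr_eq0 eq_sym; move: th12; rewrite neq_lt => /orP[/sumlt|/sumlt].
    by rewrite thE => /gt_eqF->.
  by rewrite thE => /lt_eqF->.
have BE : B = C + B * kappa by rewrite /B; field.
pose A := (1 + `|B|) * m `^ (- th2).
have A0 : 0 < A by rewrite mulr_gt0 ?powR_gt0// ltr_pwDl.
pose G x := A * x `^ th2 + B * x `^ th1.
have main : forall x, m < x -> exists k : nat,
    k%:R <= G x /\ approximable r mu k (D * k%:R / x).
  apply: (scale_ind a1 m0 ma) => [x mx x1|x x1 IH].
    have x0 : 0 < x by exact: lt_trans mx.
    exists 1%N; split; last by apply: approximable_le base; rewrite mulr1 ler_pdivlMr// ler_piMr.
    have h1 : 1 + `|B| <= A * x `^ th2.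
      rewrite -mulrA ler_peMr ?addr_ge0// powRN ler_pdivlMl ?powR_gt0// mulr1.
      by apply: ge0_ler_powR; rewrite ?nnegrE ltW.
    have h2 : `|B * x `^ th1| <= `|B|.
      rewrite normrM ler_piMr// ger0_norm ?powR_ge0//.
      by have := ge0_ler_powR (ltW th10) (ltW x0) ler01 x1; rewrite powR1.
    by have := ler_norm (- (B * x `^ th1)); rewrite normrN /G; lra.
  have x0 : 0 < x by rewrite (lt_trans ltr01).
  have /choice[k Hk] := IH.
  have [k0 [k0C nuk]] := nuC _ (ltW x1).
  exists (k0 + \sum_(i < N) k i)%N; split.
    rewrite natrD natr_sum (@le_trans _ _ (C * x `^ th1 + \sum_(i < N) G (a i * x)))//.
      by apply: lerD => //; apply: ler_sum => i _; have [] := Hk i.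
    rewrite /G big_split /= -!mulr_sumr !sum_powRM ?(ltW x0)// thE mul1r -/kappa.
    by rewrite {2}BE; lra.
  apply: approximable_le (ISM_approximable nuk (fun i => (Hk i).2)).
  rewrite natrD natr_sum mulrDr mulrDl mulr_sumr mulr_suml; apply: lerD.
    rewrite ler_piMl//; last by have /andP[] := p01 ord0.
    by rewrite divr_ge0 ?mulr_ge0// ltW.
  by apply: ler_sum => i _; rewrite cancel_weight// gt_eqF.
exists (A + `|B|); first by rewrite ltr_pwDl.
move=> x x1; have [k [kG muk]] := main x (lt_le_trans m1 x1).
exists k; split => //; rewrite (le_trans kG)// mulrDl lerD//.
  by rewrite ler_pM2l// ler_powR// le_max lexx orbT.
rewrite (le_trans (ler_norm _))// normrM ler_wpM2l//.
by rewrite ger0_norm ?powR_ge0// ler_powR// le_max lexx.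
Qed.

End ISM.

(** The exponents [th = xi / (xi + r)] and [- (r / xi) = 1 - 1 / th] convert a
    count at scale [x] into a rate in the number of points. *)
Lemma upper_rate P D A xi : 0 < xi -> 0 <= D -> 0 < A ->
  (forall x, 1 <= x -> exists k : nat,
     k%:R <= A * x `^ (xi / (xi + r)) /\ approximable r P k (D * k%:R / x)) ->
  exists2 B, 0 < B & forall n : nat, A <= n%:R ->
    (quantization_error P r n `^ r <= (B * n%:R `^ (- (r / xi)))%:E)%E.
Proof.
move=> xi0 D0 A0 H.
have xr0 : 0 < xi + r by rewrite addr_gt0.
move: H; set th := xi / (xi + r) => H; have th0 : 0 < th by rewrite divr_gt0.
have thV : th^-1 = 1 + r / xi by rewrite /th invf_div mulrDl divff// gt_eqF.
clearbody th.
exists (D * A `^ th^-1 + 1); first by rewrite ltr_pwDr// mulr_ge0 ?powR_ge0.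
move=> n An; have n0 : 0 < n%:R :> R by exact: lt_le_trans An.
pose x := (n%:R / A) `^ th^-1.
have nA : 1 <= n%:R / A by rewrite ler_pdivlMr// mul1r.
have x1 : 1 <= x.
  have := ge0_ler_powR _ ler01 (le_trans ler01 nA) nA; rewrite /x.
  by move=> /(_ th^-1); rewrite powR1 invr_ge0; apply; exact: ltW.
have [k [kA Pk]] := H x x1.
have xth : x `^ th = n%:R / A by rewrite -powRrM mulVf ?gt_eqF// powRr1// divr_ge0 ?ltW.
rewrite xth mulrC divfK ?gt_eqF// in kA.
have x0 : 0 < x by rewrite (lt_le_trans ltr01).
have kn : (k <= n)%N by rewrite -(ler_nat R).
have bd : D * k%:R / x <= (D * A `^ th^-1 + 1) * n%:R `^ (- (r / xi)).
  apply: (@le_trans _ _ (D * A `^ th^-1 * n%:R `^ (- (r / xi)))); last first.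
    by rewrite ler_wpM2r ?powR_ge0// lerDl.
  have -> : D * A `^ th^-1 * n%:R `^ (- (r / xi)) = D * n%:R / x.
    rewrite /x powRM ?invr_ge0 ?(ltW n0) ?(ltW A0)// -(powR_inv1 (ltW A0)) -powRrM mulN1r (powRN A).
    rewrite invfM invrK (_ : - (r / xi) = 1 - th^-1); last by rewrite thV; lra.
    rewrite powRD; last by rewrite (gt_eqF n0) implybT.
    by rewrite powRr1 ?(ltW n0)// powRN; ring.
  by rewrite ler_pM2r ?invr_gt0// ler_wpM2l.
apply: (@le_trans _ _ (D * k%:R / x)%:E); last by rewrite lee_fin.
apply: approximable_quantization_error => //.
  by rewrite divr_ge0 ?mulr_ge0// ltW.
exact: approximable_leq Pk.
Qed.

End upper.

(** * Lower bounds from separated balls *)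

Section separated.
Context (R : realType) (q : nat) (r : R) (r0 : 0 < r).
Local Notation rV := 'rV[R]_q.
Implicit Types (P : probability (borel_rV R q) R).

(** A point of [alpha] lies in at most one of the doubled balls, so [alpha]
    misses all but [n] of them, and each missed ball contributes [e]. *)
Lemma separated_lower P (T : eqType) (js : seq T) (z : T -> rV) (rho : T -> R)
    (e : R) (n : nat) (alpha : set rV) :
  uniq js -> 0 <= e -> (forall j, j \in js -> 0 < rho j) ->
  (forall i j, i \in js -> j \in js -> i != j ->
     2 * rho i + 2 * rho j <= enorm (z i - z j)) ->
  (forall j, j \in js -> (e%:E <= (rho j `^ r)%:E * P (eball (z j) (rho j)))%E) ->
  alpha !=set0 -> (alpha #<= `I_n)%card ->
  ((((size js)%:R - n%:R) * e)%:E <= \int[P]_x (eucl_dist x alpha `^ r)%:E)%E.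
Proof.
move=> ujs e0 rho0 sep mass al0 aln.
have fal : finite_set alpha by apply/finite_set_leP; exists n.
pose sal : seq rV := finmap.enum_fset (fset_set alpha).
have sal_size : (size sal <= n)%N by exact: geq_card_fset_set.
have salP a : (a \in sal) <-> alpha a.
  have -> : (a \in sal) = (a \in alpha) := in_fset_set fal a.
  by rewrite inE.
pose hit j := has (fun a : rV => enorm (a - z j) < 2 * rho j) sal.
pose good := [seq j <- js | ~~ hit j].
have hits : (size [seq j <- js | hit j] <= n)%N.
  (* [phi j] is a point of [alpha] in the doubled ball of [j] *)
  pose phi j := @nth rV 0 sal (find (fun a : rV => enorm (a - z j) < 2 * rho j) sal).
  apply: leq_trans sal_size; rewrite -(size_map phi); apply: uniq_leq_size.
    rewrite map_inj_in_uniq ?filter_uniq// => i j.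
    rewrite !mem_filter => /andP[hi ij] /andP[hj jj] phiE.
    apply/eqP; apply: contraT => /(sep _ _ ij jj); rewrite leNgt => /negP[].
    rewrite (le_lt_trans (enorm_triangle (phi i) _ _))// ltrD//.
      by rewrite enormC; exact: (@nth_find rV 0 _ _ hi).
    by rewrite phiE; exact: (@nth_find rV 0 _ _ hj).
  move=> _ /mapP[j + ->]; rewrite mem_filter => /andP[hj _].
  by apply: mem_nth; rewrite -has_find.
have good_size : (size js)%:R - n%:R <= (size good)%:R :> R.
  rewrite lerBlDr -natrD ler_nat -(count_predC hit js) -!size_filter addnC.
  by rewrite leq_add2l.
have gooddist j x : j \in good -> eball (z j) (rho j) x -> rho j <= eucl_dist x alpha.
  rewrite mem_filter => /andP[/hasPn hj jj] xj; apply: eucl_dist_ge => // a /salP /hj.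
  rewrite -leNgt => aj; move: xj; rewrite /eball /= => xj.
  by have := enorm_triangle x a (z j); rewrite (enormC a x); lra.
pose phi j (x : borel_rV R q) : \bar R := ((rho j `^ r)%:E * (\1_(eball (z j) (rho j)) x)%:E)%E.
have phi0 j x : (0 <= phi j x)%E by rewrite mule_ge0// lee_fin ?powR_ge0.
have mphi j : measurable_fun [set: borel_rV R q] (phi j).
  apply: measurable_funeM; apply/measurable_EFinP; apply: measurable_indic.
  exact: measurable_eball.
apply: (@le_trans _ _ (\int[P]_x (\sum_(j <- good) phi j x))%E); last first.
  apply: ge0_le_integral => //.
  - by move=> x _; apply: sume_ge0 => j _.
  - exact: emeasurable_sum.
  - exact: measurable_eucl_dist_powR.
  move=> x _.
  have [/hasP[j jg jx]|/hasPn no] := boolP (has (fun j => x \in eball (z j) (rho j)) good).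
    move: jx; rewrite inE => jx.
    have ug : uniq good by exact: filter_uniq.
    rewrite (bigD1_seq j)//= big1_seq ?adde0.
      rewrite /phi indicE mem_set// mule1 lee_fin.
      have jj : j \in js by move: jg; rewrite mem_filter => /andP[].
      apply: ge0_ler_powR; rewrite ?nnegrE ?eucl_dist_ge0 ?(ltW r0) ?(ltW (rho0 _ _))//.
      exact: gooddist.
    move=> i /andP[ij ig]; rewrite /phi indicE; case: (boolP (x \in _)); last by rewrite mule0.
    rewrite inE => ix; have jj : j \in js by move: jg; rewrite mem_filter => /andP[].
    have ii : i \in js by move: ig; rewrite mem_filter => /andP[].
    have tri : enorm (z i - z j) < rho i + rho j.
      by rewrite (le_lt_trans (enorm_triangle (x : rV) _ _))// ltrD// enormC.
    have := sep _ _ ii jj ij; rewrite leNgt => /negP[]; apply: (lt_trans tri).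
    by have := rho0 _ ii; have := rho0 _ jj; lra.
  rewrite big1_seq ?lee_fin ?powR_ge0// => j /andP[_ jg].
  by rewrite /phi indicE (negbTE (no j jg)) mule0.
rewrite ge0_integral_sum//.
apply: (@le_trans _ _ (\sum_(j <- good) e%:E)%E).
  rewrite sumEFin lee_fin big_const_seq count_predT iter_addr addr0 -[leRHS]mulr_natl.
  by rewrite ler_wpM2r.
rewrite big_seq [leRHS]big_seq; apply: lee_sum => j jg.
have jj : j \in js by move: jg; rewrite mem_filter => /andP[].
rewrite /phi ge0_integralZl_EFin ?powR_ge0//; last first.
  by apply/measurable_EFinP; apply: measurable_indic; exact: measurable_eball.
rewrite integral_indic//; last exact: measurable_eball.
by rewrite setIT; exact: mass.
Qed.

Lemma quantization_error_ge P (n : nat) (e : R) : 0 <= e ->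
  (forall alpha : set rV, alpha !=set0 -> (alpha #<= `I_n)%card ->
     (e%:E <= \int[P]_x (eucl_dist x alpha `^ r)%:E)%E) ->
  (e%:E <= quantization_error P r n `^ r)%E.
Proof.
move=> e0 H.
have le : ((e `^ r^-1)%:E <= quantization_error P r n)%E.
  apply: le_ereal_inf_tmp => _ [al [al0 aln] <-].
  rewrite -poweR_EFin; apply: gt0_ler_poweR; last exact: H.
  - by rewrite invr_ge0 ltW.
  - by rewrite in_itv /= leey lee_fin e0.
  - by rewrite in_itv /= leey andbT; apply: integral_ge0 => x _; rewrite lee_fin powR_ge0.
rewrite (_ : e = (e `^ r^-1) `^ r); last by rewrite -powRrM mulVf ?gt_eqF// powRr1.
rewrite -poweR_EFin; apply: gt0_ler_poweR => //; first exact: ltW.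
- by rewrite in_itv /= leey lee_fin powR_ge0.
- by rewrite in_itv /= leey andbT (le_trans _ le)// lee_fin powR_ge0.
Qed.

Definition separated_family P (e k : R) : Prop :=
  exists (T : eqType) (js : seq T) (z : T -> rV) (rho : T -> R),
  [/\ uniq js /\ k <= (size js)%:R, forall j, j \in js -> 0 < rho j,
    (forall i j, i \in js -> j \in js -> i != j ->
       2 * rho i + 2 * rho j <= enorm (z i - z j)) &
    forall j, j \in js -> (e%:E <= (rho j `^ r)%:E * P (eball (z j) (rho j)))%E].

(** Twice as many balls as points: at scale [x] with [L * x ^ th = 2 * n], at
    least [n] balls are missed. *)
Lemma lower_rate P c L xi x0 : 0 < xi -> 0 < c -> 0 < L ->
  (forall x, x0 <= x -> separated_family P (c / x) (L * x `^ (xi / (xi + r)))) ->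
  exists n0 : R, forall n : nat, n0 <= n%:R ->
    ((c * (L / 2) `^ ((xi + r) / xi) * n%:R `^ (- (r / xi)))%:E
     <= quantization_error P r n `^ r)%E.
Proof.
move=> xi0 c0 L0 H.
have xr0 : 0 < xi + r by rewrite addr_gt0.
move: H; rewrite -[(xi + r) / xi]invf_div.
have : 0 < xi / (xi + r) by rewrite divr_gt0.
have : (xi / (xi + r))^-1 = 1 + r / xi by rewrite invf_div mulrDl divff// gt_eqF.
move: (xi / (xi + r)) => th thV th0 H.
exists ((`|x0| + 1) `^ th * L / 2 + 1) => n nn0.
have a0 : 0 < `|x0| + 1 by rewrite ltr_wpDl.
have n0 : 0 < n%:R :> R.
  by apply: lt_le_trans nn0; rewrite ltr_wpDl// !mulr_ge0 ?powR_ge0 ?invr_ge0// ltW.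
pose y := n%:R / (L / 2); have L20 : 0 < L / 2 by rewrite divr_gt0.
have y0 : 0 < y by rewrite divr_gt0.
pose x := y `^ th^-1; have xp : 0 < x by exact: powR_gt0.
have xx0 : x0 <= x.
  apply: (@le_trans _ _ (((`|x0| + 1) `^ th) `^ th^-1)).
    rewrite -powRrM mulfV ?gt_eqF// powRr1 ?(ltW a0)//.
    by rewrite (le_trans (ler_norm _))// lerDl.
  apply: ge0_ler_powR; rewrite ?nnegrE ?invr_ge0 ?powR_ge0 ?(ltW th0) ?(ltW y0)//.
  by rewrite /y ler_pdivlMr// mulrA (le_trans _ nn0)// lerDl.
have [T [js [z [rho [[ujs size_js] rho0 sep mass]]]]] := H x xx0.
have xth : x `^ th = y by rewrite -powRrM mulVf ?gt_eqF// powRr1 ?(ltW y0).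
have js2 : 2 * n%:R <= (size js)%:R :> R.
  apply: le_trans size_js; rewrite xth /y le_eqVlt; apply/orP; left; apply/eqP.
  by field; rewrite gt_eqF.
apply: quantization_error_ge; first by rewrite !mulr_ge0 ?powR_ge0 ?(ltW c0).
move=> al al0 aln.
apply: le_trans (separated_lower ujs _ rho0 sep mass al0 aln); last first.
  by rewrite divr_ge0 ?ltW.
rewrite lee_fin; apply: (@le_trans _ _ (n%:R * (c / x))); last first.
  rewrite ler_wpM2r ?divr_ge0 ?(ltW c0) ?(ltW xp)//.
  by move: js2; rewrite mulr_natl mulr2n; lra.
rewrite le_eqVlt; apply/orP; left; apply/eqP.
have xE : x = n%:R `^ th^-1 / (L / 2) `^ th^-1.
  rewrite /x /y [LHS]powRM ?invr_ge0 ?(ltW n0) ?(ltW L20)//; congr (_ * _).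
  by rewrite -(powR_inv1 (ltW L20)) -powRrM mulN1r powRN.
rewrite xE (_ : - (r / xi) = 1 - th^-1); last by rewrite thV; lra.
rewrite [n%:R `^ (1 - _)]powRD; last by rewrite (gt_eqF n0) implybT.
rewrite (powRr1 (ltW n0)) powRN.
have h1 : n%:R `^ th^-1 != 0 by rewrite gt_eqF// powR_gt0.
have h2 : (L / 2) `^ th^-1 != 0 by rewrite gt_eqF// powR_gt0.
move: (n%:R `^ th^-1) ((L / 2) `^ th^-1) h1 h2 => u v u0 v0.
by field; rewrite u0 v0.
Qed.

End separated.

(** The set for [x > 1] collects the sets for [b i * x], prefixed by [i]; the size
    keeps up with [x ^ th] because the [b i ^ th] sum to [1]. *)
Lemma word_family (R : realType) (n : nat) (b : 'I_n -> R) (th m : R) :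
  0 < th -> (forall i, 0 < b i < 1) -> \sum_(i < n) b i `^ th = 1 ->
  0 < m -> (forall i, m <= b i) ->
  forall x, m < x -> exists F : seq (seq 'I_n),
    [/\ uniq F, (forall u v, u \in F -> v \in F -> u != v -> incomparable u v),
      x `^ th <= (size F)%:R & forall u, u \in F -> m <= wprod b u * x].
Proof.
move=> th0 b01 bth m0 mb.
have b1 i : b i < 1 by have /andP[] := b01 i.
have b0 i : 0 < b i by have /andP[] := b01 i.
apply: (scale_ind b1 m0 mb) => [x mx x1|x x1 IH].
  have x0 : 0 < x by exact: lt_trans mx.
  exists [:: [::]]; split => //.
  - by move=> u v; rewrite !inE => /eqP -> /eqP ->; rewrite eqxx.
  - by have := ge0_ler_powR (ltW th0) (ltW x0) ler01 x1; rewrite powR1.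
  - by move=> u; rewrite inE => /eqP ->; rewrite wprod0 mul1r ltW.
have x0 : 0 < x by rewrite (lt_trans ltr01).
have /choice[F HF] := IH.
exists [seq i :: u | i <- index_enum 'I_n, u <- F i]; split.
- apply: allpairs_uniq_dep; first exact: index_enum_uniq.
    by move=> i _; have [] := HF i.
  by move=> [i u] [j v] _ _ [-> ->].
- move=> _ _ /allpairsPdep[i [u [_ ui ->]]] /allpairsPdep[j [v [_ vj ->]]] /=.
  have [ij|//] := eqVneq i j; rewrite -ij in vj *; rewrite eqseq_cons eqxx /=.
  by have [_ + _ _] := HF i; exact.
- rewrite size_allpairs_dep sumnE big_map natr_sum.
  rewrite -[leLHS]mul1r -[X in X * _ <= _]bth -sum_powRM ?(ltW x0)//.
  by apply: ler_sum => i _; have [] := HF i.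
- move=> _ /allpairsPdep[i [u [_ ui ->]]]; rewrite wprod_cons -mulrA mulrCA.
  by have [_ _ _] := HF i; exact.
Qed.

(** The index set consists of pairs: a prefix [t] from a fixed finite set [W]
    and a word [u] of the system with ratios [b] at the scale left by [t]. *)
Lemma pair_lower_rate (R : realType) (q : nat) (r : R) (P : probability (borel_rV R q) R)
    (n : nat) (I : eqType) (W : seq I) (wt : I -> R)
    (b : 'I_n -> R) (m L xi C d : R)
    (z : I -> seq 'I_n -> 'rV[R]_q) (l : I -> seq 'I_n -> R) :
  0 < r -> 0 < xi -> (forall i, 0 < b i < 1) ->
  \sum_(i < n) b i `^ (xi / (xi + r)) = 1 ->
  0 < m -> (forall i, m <= b i) -> uniq W -> (forall t, t \in W -> 0 < wt t) ->
  0 < L -> L <= \sum_(t <- W) wt t `^ (xi / (xi + r)) -> 0 < C -> 0 < d ->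
  (forall t u, 0 < l t u) ->
  (forall t u v, t \in W -> incomparable u v ->
     d * Num.max (l t u) (l t v) <= enorm (z t u - z t v)) ->
  (forall t t' u v, t \in W -> t' \in W -> t != t' ->
     d * Num.max (l t u) (l t' v) <= enorm (z t u - z t' v)) ->
  (forall t u, t \in W ->
     ((C * (wt t * wprod b u))%:E
      <= ((d / 4 * l t u) `^ r)%:E * P (eball (z t u) (d / 4 * l t u)))%E) ->
  exists n0 : R, forall k : nat, n0 <= k%:R ->
    ((C * m * (L / 2) `^ ((xi + r) / xi) * k%:R `^ (- (r / xi)))%:E
     <= quantization_error P r k `^ r)%E.
Proof.
move=> r0 xi0 b01 bth m0 mb uW W0 L0 LW C0 d0 l0 sep1 sep2 mass.
have th0 : 0 < xi / (xi + r) by rewrite divr_gt0// addr_gt0.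
pose x0 := \sum_(t <- W) m / wt t + 1.
have x0p : 0 < x0.
  rewrite ltr_wpDl// big_seq; apply: sumr_ge0 => t tW.
  by rewrite divr_ge0 ?(ltW m0) ?(ltW (W0 _ _)).
apply: (@lower_rate _ _ _ r0 _ _ _ _ x0) => //; first by rewrite mulr_gt0.
move=> x xx0; have xp : 0 < x by exact: lt_le_trans xx0.
have tx t : t \in W -> m < wt t * x.
  move=> tW; rewrite mulrC -ltr_pdivrMr ?W0//; apply: lt_le_trans xx0.
  rewrite /x0 (bigD1_seq t)//= -addrA ltrDl ltr_wpDl// big_seq_cond.
  by apply: sumr_ge0 => s /andP[sW _]; rewrite divr_ge0 ?(ltW m0) ?(ltW (W0 _ _)).
have /choice[F HF] : forall t, exists F : seq (seq 'I_n), t \in W ->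
    [/\ uniq F, (forall u v, u \in F -> v \in F -> u != v -> incomparable u v),
      (wt t * x) `^ (xi / (xi + r)) <= (size F)%:R &
      forall u, u \in F -> m <= wprod b u * (wt t * x)].
  move=> t; have [tW|_] := boolP (t \in W); last by exists [::].
  by have [F HF] := word_family th0 b01 bth m0 mb (tx _ tW); exists F.
exists (I * seq 'I_n)%type, [seq (t, u) | t <- W, u <- F t],
  (fun j => z j.1 j.2), (fun j => d / 4 * l j.1 j.2).
have inF j : j \in [seq (t, u) | t <- W, u <- F t] -> j.1 \in W /\ j.2 \in F j.1.
  by move=> /allpairsPdep[t [u [tW uF ->]]].
split; [split| | |].
- apply: allpairs_uniq_dep => //; first by move=> t /HF[].
  by move=> [t u] [s v] _ _ [-> ->].
- rewrite size_allpairs_dep sumnE big_map natr_sum.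
  apply: (@le_trans _ _ ((\sum_(t <- W) wt t `^ (xi / (xi + r))) * x `^ (xi / (xi + r)))).
    by rewrite ler_wpM2r ?powR_ge0.
  rewrite mulr_suml [leLHS]big_seq [leRHS]big_seq; apply: ler_sum => t tW.
  by rewrite -powRM ?(ltW xp) ?(ltW (W0 _ tW))//; have [] := HF t tW.
- by move=> j _; rewrite mulr_gt0// divr_gt0.
- move=> [t u] [s v] /inF[/= tW uF] /inF[/= sW vF] ts.
  have : d * Num.max (l t u) (l s v) <= enorm (z t u - z s v).
    have [tsE|ts'] := eqVneq t s; last exact: sep2.
    rewrite -tsE in vF ts *; apply: sep1 => //.
    have [_ h _ _] := HF t tW; apply: h => //.
    by apply: contraNneq ts => ->.
  apply: le_trans.
  have h1 : d * l t u <= d * Num.max (l t u) (l s v) by rewrite ler_pM2l// le_max lexx.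
  have h2 : d * l s v <= d * Num.max (l t u) (l s v) by rewrite ler_pM2l// le_max lexx orbT.
  by lra.
- move=> [t u] /inF[/= tW uF]; apply: le_trans (mass _ _ tW); rewrite lee_fin.
  have [_ _ _ /(_ u uF) mu] := HF t tW.
  rewrite -mulrA ler_pM2l// ler_pdivrMr//.
  by rewrite mulrAC (mulrC (wt t * x)).
Qed.

(** * Words scored by two weight systems *)

Fixpoint words (n k : nat) : seq (seq 'I_n) :=
  if k is k'.+1 then [seq i :: w | i <- index_enum 'I_n, w <- words n k'] else [:: [::]].

(** The sum, over the suffixes [v] with [w = u ++ v], of the weight [a] of [u]
    times the weight [b] of [v]. *)
Fixpoint split_weight (R : realType) (n : nat) (a b : 'I_n -> R) (w : seq 'I_n) : R :=
  if w is i :: w' then wprod b w + a i * split_weight a b w' else 1.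

Section words_sums.
Context (R : realType) (n : nat).
Implicit Types (a b : 'I_n -> R).

Lemma sum_wordsS k (F : seq 'I_n -> R) :
  \sum_(w <- words n k.+1) F w = \sum_(i < n) \sum_(w <- words n k) F (i :: w).
Proof. by rewrite /= big_allpairs_dep. Qed.

Lemma size_words k w : w \in words n k -> size w = k.
Proof.
elim: k w => [|k IH] w /=; first by rewrite inE => /eqP->.
by move=> /allpairsPdep[i [v [_ /IH <- ->]]].
Qed.

Lemma uniq_words k : uniq (words n k).
Proof.
elim: k => //= k IH; apply: allpairs_uniq_dep; first exact: index_enum_uniq.
  by move=> i _.
by move=> [i u] [j v] _ _ [-> ->].
Qed.

Lemma incomparable_words k u v : u \in words n k -> v \in words n k -> u != v ->
  incomparable u v.
Proof.
move=> /size_words su /size_words sv uv; apply: contraT => /comparable_words.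
move: su; rewrite -{}sv => suv [] [[|i w] E].
- by rewrite E cats0 eqxx in uv.
- by move/eqP: suv; rewrite E size_cat /= -[X in X == _]addn0 eqn_add2l.
- by rewrite E cats0 eqxx in uv.
- by move/eqP: suv; rewrite E size_cat /= -[X in _ == X]addn0 eqn_add2l.
Qed.

Lemma sum_words_wprod a k : \sum_(w <- words n k) wprod a w = (\sum_(i < n) a i) ^+ k.
Proof.
elim: k => [|k IH]; first by rewrite big_seq1 wprod0 expr0.
rewrite sum_wordsS exprS mulr_suml; apply: eq_bigr => i _.
by rewrite -IH mulr_sumr; apply: eq_bigr => w _; rewrite wprod_cons.
Qed.

Lemma split_weight_gt0 a b w : (forall i, 0 < a i) -> (forall i, 0 < b i) ->
  0 < split_weight a b w.
Proof.
by move=> a0 b0; elim: w => //= i w IH; rewrite addr_gt0 ?mulr_gt0// wprod_gt0.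
Qed.

Lemma split_weightM a b (c : 'I_n -> R) w :
  split_weight (fun i => a i * c i) (fun i => b i * c i) w = split_weight a b w * wprod c w.
Proof.
elim: w => [|i w IH]; first by rewrite /= wprod0 mulr1.
by rewrite [LHS]/= IH wprodM /= !wprod_cons; ring.
Qed.

(** Strict Cauchy-Schwarz for distinct unit vectors. *)
Lemma sum_sqr_gap (al be : 'I_n -> R) :
  \sum_(i < n) al i ^+ 2 = 1 -> \sum_(i < n) be i ^+ 2 = 1 ->
  (exists i, al i != be i) -> \sum_(i < n) al i * be i < 1.
Proof.
move=> ale bee [i0 neq].
have : 0 < \sum_(i < n) (al i - be i) ^+ 2.
  rewrite (bigD1 i0)//= ltr_pwDl//; first by rewrite exprn_even_gt0//= subr_eq0.
  by apply: sumr_ge0 => i _; exact: sqr_ge0.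
have -> : \sum_(i < n) (al i - be i) ^+ 2 =
    \sum_(i < n) al i ^+ 2 + \sum_(i < n) be i ^+ 2 - 2 * \sum_(i < n) al i * be i.
  by rewrite mulr_sumr -big_split -sumrB; apply: eq_bigr => i _ /=; ring.
by rewrite ale bee; lra.
Qed.

(** Given distinct unit vectors [al] and [be], the products with a prefix in
    [al] and a suffix in [be] are almost orthogonal for distinct cut positions:
    [h k] below sums a geometric series. By Cauchy-Schwarz, the squares of a
    function [S] that dominates all these products sum to the order of [k]. *)
Lemma sum_dominating (al be : 'I_n -> R) (S : seq 'I_n -> R) k :
  (forall i, 0 <= al i) -> (forall i, 0 <= be i) ->
  \sum_(i < n) al i ^+ 2 = 1 -> \sum_(i < n) be i ^+ 2 = 1 ->
  \sum_(i < n) al i * be i < 1 ->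
  (forall w, wprod be w <= S w) -> (forall i w, al i * S w <= S (i :: w)) ->
  k.+1%:R * (1 - \sum_(i < n) al i * be i) <= 3 * \sum_(w <- words n k) S w ^+ 2.
Proof.
move=> al0 be0 ale bee; set rho := \sum_(i < n) al i * be i => rho1 beS alS.
(* for the products over all cuts of [w], [T] is the sum and [A] the sum of squares *)
pose T := fix T w := if w is i :: w' then wprod be w + al i * T w' else 1.
pose A := fix A w := if w is i :: w' then wprod be w ^+ 2 + al i ^+ 2 * A w' else 1.
have wb0 w : 0 <= wprod be w by apply: prodr_ge0.
have S0 w : 0 <= S w by exact: le_trans (beS w).
have T0 w : 0 <= T w.
  by elim: w => //= i w IH; rewrite addr_ge0 ?mulr_ge0.
have rho0 : 0 <= rho by apply: sumr_ge0 => i _; exact: mulr_ge0.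
have AST w : A w <= S w * T w.
  elim: w => [|i w IH] /=; first by rewrite mulr1; have := beS [::]; rewrite wprod0.
  rewrite mulrDr lerD// ?expr2 ?ler_wpM2r//.
  apply: (@le_trans _ _ (al i * al i * (S w * T w))); first by rewrite ler_wpM2l ?mulr_ge0.
  by rewrite mulrACA ler_wpM2r ?mulr_ge0.
have wb2 j : \sum_(w <- words n j) wprod be w ^+ 2 = 1.
  rewrite (eq_bigr (wprod (fun i => be i ^+ 2))); last first.
    by move=> w _; rewrite /wprod prodrXl.
  by rewrite sum_words_wprod bee expr1n.
have sumA j : \sum_(w <- words n j) A w = j.+1%:R.
  elim: j => [|j IH]; first by rewrite big_seq1.
  rewrite sum_wordsS -[RHS]natr1 -IH addrC -(wb2 j.+1) sum_wordsS -[X in _ + X]mul1r.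
  rewrite -ale mulr_suml -big_split /=; apply: eq_bigr => i _.
  by rewrite mulr_sumr -big_split /=.
pose h j := \sum_(w <- words n j) wprod be w * T w.
have hS j : h j.+1 = 1 + rho * h j.
  rewrite /h sum_wordsS -(wb2 j.+1) sum_wordsS mulr_suml -big_split /=.
  apply: eq_bigr => i _; rewrite mulr_sumr -big_split /=; apply: eq_bigr => w _.
  by rewrite wprod_cons; ring.
have h0 j : h j * (1 - rho) <= 1.
  elim: j => [|j IH]; first by rewrite /h big_seq1 /= wprod0 !mul1r gerBl.
  rewrite hS mulrDl mul1r -mulrA.
  have : rho * (h j * (1 - rho)) <= rho * 1 by rewrite ler_wpM2l.
  lra.
have T2 j : (\sum_(w <- words n j) T w ^+ 2) * (1 - rho) <= j.+1%:R * 2.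
  elim: j => [|j IH]; first by rewrite big_seq1 expr1n; lra.
  rewrite sum_wordsS (_ : \sum_(i < n) _ =
    1 + 2 * rho * h j + \sum_(w <- words n j) T w ^+ 2); last first.
    rewrite (eq_bigr (fun i => \sum_(w <- words n j) wprod be (i :: w) ^+ 2
        + 2 * (al i * be i) * h j + al i ^+ 2 * \sum_(w <- words n j) T w ^+ 2)).
      by rewrite !big_split /= -(sum_wordsS j (fun w => wprod be w ^+ 2)) wb2
        -!mulr_suml -mulr_sumr ale mul1r.
    move=> i _; rewrite /h !mulr_sumr -!big_split /=; apply: eq_bigr => w _.
    by rewrite wprod_cons; ring.
  have : rho * (h j * (1 - rho)) <= rho * 1 by rewrite ler_wpM2l.
  rewrite -[j.+2%:R]natr1; nra.
have rp : 0 < 1 - rho by rewrite subr_gt0.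
(* Young's inequality for [AST], with the weight that balances [sumA] and [T2] *)
have AS w : A w * (2 * (1 - rho)) <= 3 * S w ^+ 2 + (1 - rho) * (1 - rho) / 3 * T w ^+ 2.
  have := AST w; have := sqr_ge0 (3 * S w - (1 - rho) * T w).
  have := S0 w; have := T0 w; nra.
have : \sum_(w <- words n k) A w * (2 * (1 - rho)) <=
    \sum_(w <- words n k) (3 * S w ^+ 2 + (1 - rho) * (1 - rho) / 3 * T w ^+ 2).
  by apply: ler_sum.
rewrite -mulr_suml sumA big_split /= -!mulr_sumr.
have := T2 k; have : 0 <= k.+1%:R :> R by [].
move: (\sum_(w <- words n k) T w ^+ 2) (\sum_(w <- words n k) S w ^+ 2) => X Y.
nra.
Qed.

(** The powers [a ^ (th / 2)] and [b ^ (th / 2)] are distinct unit vectors, and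
    [split_weight a b] dominates each term of its sum. *)
Lemma split_weight_unbounded a b th L : 0 < th ->
  (forall i, 0 < a i) -> (forall i, 0 < b i) ->
  \sum_(i < n) a i `^ th = 1 -> \sum_(i < n) b i `^ th = 1 -> (exists i, a i != b i) ->
  exists k, L <= \sum_(w <- words n k) split_weight a b w `^ th.
Proof.
move=> th0 a0 b0 ath bth [i0 ab].
pose al i := a i `^ (th / 2); pose be i := b i `^ (th / 2).
have th20 : 0 < th / 2 by rewrite divr_gt0.
have sqE x : (x `^ (th / 2)) ^+ 2 = x `^ th.
  by rewrite -powR_mulrn ?powR_ge0// -powRrM divfK.
have ale : \sum_(i < n) al i ^+ 2 = 1 by rewrite -ath; apply: eq_bigr => i _; exact: sqE.
have bee : \sum_(i < n) be i ^+ 2 = 1 by rewrite -bth; apply: eq_bigr => i _; exact: sqE.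
have gap : \sum_(i < n) al i * be i < 1.
  apply: sum_sqr_gap => //; exists i0; apply: contraNneq ab => E.
  by apply/eqP; apply: (powR_injective th20 _ _ E); rewrite nnegrE ltW.
set rho := \sum_(i < n) _ in gap.
pose S w := split_weight a b w `^ (th / 2).
have sw0 w := split_weight_gt0 w a0 b0.
exists (Num.truncn (3 * L / (1 - rho))).
have -> : \sum_(w <- words n (Num.truncn (3 * L / (1 - rho)))) split_weight a b w `^ th =
    \sum_(w <- words n (Num.truncn (3 * L / (1 - rho)))) S w ^+ 2.
  by apply: eq_bigr => w _; rewrite sqE.
have rp : 0 < 1 - rho by rewrite subr_gt0.
have := @sum_dominating al be S (Num.truncn (3 * L / (1 - rho))).
move=> /(_ _ _ ale bee gap); rewrite -/rho.
have : 3 * L < (Num.truncn (3 * L / (1 - rho))).+1%:R * (1 - rho).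
  by rewrite -ltr_pdivrMr// truncnS_gt.
move=> lt H; suff : (Num.truncn (3 * L / (1 - rho))).+1%:R * (1 - rho) <=
  3 * \sum_(w <- words n (Num.truncn (3 * L / (1 - rho)))) S w ^+ 2 by lra.
apply: H.
- by move=> i; exact: powR_ge0.
- by move=> i; exact: powR_ge0.
- move=> w; rewrite /be wprod_powR// /S; apply: ge0_ler_powR.
  all: rewrite ?nnegrE ?(ltW th20) ?(ltW (sw0 _)) ?(ltW (wprod_gt0 _ _))//.
  by case: w => [|i w] /=; rewrite ?wprod0// lerDl mulr_ge0 ?(ltW (a0 i)) ?(ltW (sw0 _)).
- move=> i w; rewrite /al /S -powRM ?(ltW (a0 i)) ?(ltW (sw0 _))//.
  apply: ge0_ler_powR; rewrite ?nnegrE ?(ltW th20) ?mulr_ge0 ?(ltW (a0 i)) ?(ltW (sw0 _))//.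
  by rewrite /= lerDr ltW// wprod_gt0.
Qed.

End words_sums.

(** * Lower bounds for in-homogeneous self-similar measures *)

Section masses.
Context (R : realType) (q : nat).
Local Notation rV := 'rV[R]_q.
Implicit Types (P nu mu : probability (borel_rV R q) R).

Lemma preimage_eball (f : rV -> rV) s x c : contractive_similitude f s ->
  f @^-1` eball (f x) (s * c) = eball x c.
Proof.
move=> [/andP[s0 _] fs]; rewrite predeqE => y; rewrite /eball /=.
by rewrite fs ltr_pM2l.
Qed.

Lemma self_similar_mass P n (g : 'I_n -> rV -> rV) c (t : 'I_n -> R) y rho u :
  (forall i, contractive_similitude (g i) (c i)) -> (forall i, 0 < t i) ->
  is_self_similar_measure g t P ->
  ((wprod t u)%:E * P (eball y rho) <= P (eball (foldr g y u) (wprod c u * rho)))%E.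
Proof.
move=> cg t0 PE; elim: u => [|i u IH]; first by rewrite !wprod0 mul1e mul1r.
rewrite [leRHS]PE; last exact: measurable_eball.
apply: (@le_trans _ _ ((t i)%:E * P (eball (foldr g y u) (wprod c u * rho)))%E).
  rewrite wprod_cons EFinM -muleA; apply: lee_wpmul2l => //.
  by rewrite lee_fin ltW.
rewrite (bigD1 i)//= wprod_cons -mulrA preimage_eball// leeDl// sume_ge0// => j _.
by rewrite mule_ge0// lee_fin ltW.
Qed.

Lemma msupport_ball P x d : msupport P x -> 0 < d ->
  exists2 e, 0 < e & (e%:E <= P (eball x d))%E.
Proof.
move=> /(_ _ (@eball_open _ _ x d) (eball_center x _)) h d0.
have fin : P (eball x d) \is a fin_num.
  by apply: fin_num_measure; exact: measurable_eball.
exists (fine (P (eball x d))); last by rewrite fineK.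
by rewrite -lte_fin fineK// h.
Qed.

Section ISM.
Context (n : nat) (f : 'I_n -> rV -> rV) (s : 'I_n -> R) (p : 'I_n.+1 -> R).
Context (nu mu : probability (borel_rV R q) R).
Hypothesis fs : forall i, contractive_similitude (f i) (s i).
Hypothesis p0 : forall i, 0 < p i.
Hypothesis muE : is_ISM f p nu mu.
Let p' (i : 'I_n) := p (lift ord0 i).
Let p'0 i : 0 < p' i. Proof. exact: p0. Qed.

Lemma ISM_ge_nu (A : set (borel_rV R q)) : measurable A ->
  ((p ord0)%:E * nu A <= mu A)%E.
Proof.
move=> mA; rewrite [leRHS]muE// leeDl// sume_ge0// => j _.
by rewrite mule_ge0// lee_fin ltW.
Qed.

Lemma ISM_ge_step (A : set (borel_rV R q)) i : measurable A ->
  ((p ord0)%:E * nu A + (p' i)%:E * mu (f i @^-1` A) <= mu A)%E.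
Proof.
move=> mA; rewrite [leRHS]muE//; apply: leeD => //.
rewrite (bigD1 i)//= leeDl// sume_ge0// => j _.
by rewrite mule_ge0// lee_fin ltW.
Qed.

Lemma ISM_mass y rho u :
  ((wprod p' u)%:E * mu (eball y rho) <= mu (eball (foldr f y u) (wprod s u * rho)))%E.
Proof.
elim: u => [|i u IH]; first by rewrite !wprod0 mul1e mul1r.
apply: le_trans (ISM_ge_step i (measurable_eball _ _)).
rewrite /= wprod_cons EFinM -muleA (wprod_cons s) -mulrA preimage_eball//.
apply: (@le_trans _ _ ((p' i)%:E * mu (eball (foldr f y u) (wprod s u * rho)))%E).
  by apply: lee_wpmul2l => //; rewrite lee_fin; exact: ltW (p0 _).
by rewrite leeDr// mule_ge0// lee_fin; exact: ltW (p0 _).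
Qed.

(** When [nu] is self-similar for the same maps, the mass of a piece collects a
    contribution from every way to cut its word. *)
Lemma ISM_split_mass (t : 'I_n -> R) y rho u :
  (forall i, 0 < t i) -> is_self_similar_measure f t nu ->
  ((p ord0 * split_weight p' t u)%:E * nu (eball y rho)
   <= mu (eball (foldr f y u) (wprod s u * rho)))%E.
Proof.
move=> t0 nuE; elim: u => [|i u IH].
  by rewrite wprod0 mul1r mulr1; apply: ISM_ge_nu; exact: measurable_eball.
apply: le_trans (ISM_ge_step i (measurable_eball _ _)).
rewrite [split_weight _ _ _]/= mulrDr EFinD ge0_muleDl ?lee_fin; last 2 first.
- by rewrite mulr_ge0 ?(ltW (p0 _)) ?(ltW (wprod_gt0 _ _)).
- by rewrite !mulr_ge0 ?(ltW (p0 _)) ?(ltW (p'0 _)) ?(ltW (split_weight_gt0 _ p'0 t0)).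
apply: leeD.
  rewrite EFinM -muleA; apply: lee_wpmul2l; first by rewrite lee_fin ltW.
  exact: self_similar_mass.
rewrite wprod_cons -mulrA preimage_eball// mulrCA EFinM -muleA.
by apply: lee_wpmul2l => //; rewrite lee_fin; exact: ltW (p0 _).
Qed.

End ISM.

End masses.

Section lower.
Context (R : realType) (q : nat) (r : R) (r0 : 0 < r).
Local Notation rV := 'rV[R]_q.
Implicit Types (P nu mu : probability (borel_rV R q) R).

Definition separated_orbit n (g : 'I_n -> rV -> rV) (c : 'I_n -> R) (x : rV) (d : R) : Prop :=
  forall u v, incomparable u v ->
    d * Num.max (wprod c u) (wprod c v) <= enorm (foldr g x u - foldr g x v).

Lemma separated_orbit_le n (g : 'I_n -> rV -> rV) c x d d' : (forall i, 0 < c i) ->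
  d' <= d -> separated_orbit g c x d -> separated_orbit g c x d'.
Proof.
move=> c0 dd H u v /H; apply: le_trans; rewrite ler_wpM2r// le_max.
by rewrite (ltW (wprod_gt0 _ _)).
Qed.

Lemma wprod_weight n (t c : 'I_n -> R) u : (forall i, 0 < c i) ->
  wprod (fun i => t i * c i `^ r) u = wprod t u * wprod c u `^ r.
Proof. by move=> c0; rewrite wprodM wprod_powR. Qed.

(** A single system: the prefix is trivial. *)
Lemma orbit_lower_rate P n (g : 'I_n -> rV -> rV) (c t : 'I_n -> R) x d C xi :
  (forall i, contractive_similitude (g i) (c i)) -> (forall i, 0 < t i <= 1) ->
  0 < xi -> \sum_(i < n) (t i * c i `^ r) `^ (xi / (xi + r)) = 1 ->
  0 < d -> separated_orbit g c x d -> 0 < C ->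
  (forall u, ((C * wprod t u)%:E <= P (eball (foldr g x u) (d / 4 * wprod c u)))%E) ->
  exists n0 B : R, 0 < B /\ forall k : nat, n0 <= k%:R ->
    ((B * k%:R `^ (- (r / xi)))%:E <= quantization_error P r k `^ r)%E.
Proof.
move=> cg t01 xi0 xiE d0 sep C0 mass.
have c0 i : 0 < c i by have [/andP[]] := cg i.
pose b i := t i * c i `^ r.
have b01 i : 0 < b i < 1 by apply: weight_lt1 => //; have [] := cg i.
have [m /andP[m0 _] mb] := finite_lower_bound (fun i => let: conj h _ := andP (b01 i) in h).
pose C' := C * (d / 4) `^ r.
have C'0 : 0 < C' by rewrite mulr_gt0// powR_gt0// divr_gt0.
have [] := @pair_lower_rate R q r P n unit [:: tt] (fun=> 1) b m 1 xi C' d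
  (fun _ u => foldr g x u) (fun _ u => wprod c u) r0 xi0 b01 xiE m0 mb isT.
- by [].
- exact: ltr01.
- by rewrite big_seq1 powR1.
- exact: C'0.
- exact: d0.
- by move=> _ u; exact: wprod_gt0.
- by move=> _ u v _; exact: sep.
- by move=> [] [].
- move=> _ u _; rewrite mul1r wprod_weight// powRM ?(ltW (wprod_gt0 _ _)) ?divr_ge0 ?(ltW d0)//.
  apply: le_trans (lee_wpmul2l _ (mass u)); last by rewrite lee_fin mulr_ge0 ?powR_ge0.
  by rewrite -EFinM lee_fin /C' le_eqVlt; apply/orP; left; apply/eqP; ring.
move=> n0 H; exists n0, (C' * m * (1 / 2) `^ ((xi + r) / xi)); split => //.
by rewrite !mulr_gt0 ?powR_gt0// divr_gt0.
Qed.

(** Families of unbounded total weight [L] beat every constant. *)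
Lemma pair_lower_unbounded P (n : nat) (I : eqType) (wt : I -> R)
    (b : 'I_n -> R) (xi C d : R) (z : I -> seq 'I_n -> rV) (l : I -> seq 'I_n -> R)
    (ok : I -> I -> Prop) :
  0 < xi -> (forall i, 0 < b i < 1) -> \sum_(i < n) b i `^ (xi / (xi + r)) = 1 ->
  (forall t, 0 < wt t) -> 0 < C -> 0 < d -> (forall t u, 0 < l t u) ->
  (forall t u v, incomparable u v -> d * Num.max (l t u) (l t v) <= enorm (z t u - z t v)) ->
  (forall t t' u v, ok t t' -> d * Num.max (l t u) (l t' v) <= enorm (z t u - z t' v)) ->
  (forall t u, ((C * (wt t * wprod b u))%:E
      <= ((d / 4 * l t u) `^ r)%:E * P (eball (z t u) (d / 4 * l t u)))%E) ->
  (forall L, exists W : seq I, [/\ uniq W,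
     (forall t t', t \in W -> t' \in W -> t != t' -> ok t t') &
     L <= \sum_(t <- W) wt t `^ (xi / (xi + r))]) ->
  forall B, exists n0 : R, forall k : nat, n0 <= k%:R ->
    ((B * k%:R `^ (- (r / xi)))%:E <= quantization_error P r k `^ r)%E.
Proof.
move=> xi0 b01 bE wt0 C0 d0 l0 sep1 sep2 mass big B.
have [m /andP[m0 _] mb] := finite_lower_bound (fun i => let: conj h _ := andP (b01 i) in h).
have Cm0 : 0 < C * m by rewrite mulr_gt0.
pose L := 2 * Num.max 1 (B / (C * m)).
have L2 : L / 2 = Num.max 1 (B / (C * m)) by rewrite /L mulrC mulKf.
have L0 : 0 < L by rewrite mulr_gt0// lt_max ltr01.
have [W [uW okW LW]] := big L.
have [n0 Hn0] := @pair_lower_rate R q r P n I W wt b m L xi C d z l r0 xi0 b01 bE m0 mb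
  uW (fun t _ => wt0 t) L0 LW C0 d0 l0 (fun t u v _ => sep1 t u v)
  (fun t t' u v tW tW' tt => sep2 t t' u v (okW t t' tW tW' tt)) (fun t u _ => mass t u).
exists n0 => k /Hn0; apply: le_trans; rewrite lee_fin ler_wpM2r ?powR_ge0//.
rewrite mulrC -ler_pdivrMr//.
apply: (@le_trans _ _ (L / 2)); first by rewrite L2 le_max lexx orbT.
apply: le1r_powR; first by rewrite L2 le_max lexx.
by rewrite mulrDl divff ?gt_eqF// lerDl divr_ge0 ?ltW.
Qed.

Section case_same.
Context (n : nat) (f : 'I_n -> rV -> rV) (s : 'I_n -> R) (p : 'I_n.+1 -> R) (t : 'I_n -> R).
Context (nu mu : probability (borel_rV R q) R).
Hypothesis fs : forall i, contractive_similitude (f i) (s i).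
Hypothesis p0 : forall i, 0 < p i.
Hypothesis psum : \sum_(i < n.+1) p i = 1.
Hypothesis muE : is_ISM f p nu mu.
Hypothesis t01 : forall i, 0 < t i <= 1.
Hypothesis tsum : \sum_(i < n) t i = 1.
Hypothesis nuE : is_self_similar_measure f t nu.
Let p' (i : 'I_n) := p (lift ord0 i).
Let p'0 i : 0 < p' i. Proof. exact: p0. Qed.

(** The vectors [p'] and [t] differ because their sums do. *)
Lemma case_same_unbounded x d xi : 0 < xi ->
  \sum_(i < n) (p' i * s i `^ r) `^ (xi / (xi + r)) = 1 ->
  \sum_(i < n) (t i * s i `^ r) `^ (xi / (xi + r)) = 1 ->
  msupport nu x -> 0 < d -> separated_orbit f s x d ->
  forall B, exists n0 : R, forall k : nat, n0 <= k%:R ->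
    ((B * k%:R `^ (- (r / xi)))%:E <= quantization_error mu r k `^ r)%E.
Proof.
move=> xi0 aE bE nux d0 sep.
have s0 i : 0 < s i by have [/andP[]] := fs i.
have t0 i : 0 < t i by have /andP[] := t01 i.
pose a i := p' i * s i `^ r; pose b i := t i * s i `^ r.
have b01 i : 0 < b i < 1 by apply: weight_lt1 => //; have [] := fs i.
have a0 i : 0 < a i by rewrite mulr_gt0 ?powR_gt0// p0.
have b0 i : 0 < b i by have /andP[] := b01 i.
have d4 : 0 < d / 4 by rewrite divr_gt0.
have [e e0 nue] := msupport_ball nux d4.
have th0 : 0 < xi / (xi + r) by rewrite divr_gt0// addr_gt0.
have ab : exists i, a i != b i.
  apply: contrapT => /forallNP H; have E i : p' i = t i.
    have abE : a i = b i by apply/eqP; apply: contrapT => /negP; exact: H.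
    by move: abE; apply: mulIf; rewrite gt_eqF// powR_gt0.
  have := psum; rewrite big_ord_recl (eq_bigr t) => [|i _]; last exact: E.
  by rewrite tsum; have := p0 ord0; lra.
pose C := p ord0 * e * (d / 4) `^ r.
have C0 : 0 < C by rewrite !mulr_gt0// powR_gt0.
apply: (@pair_lower_unbounded mu n _ (split_weight a b) b xi C d
  (fun w u => foldr f x (w ++ u)) (fun w u => wprod s (w ++ u))
  (fun w w' => incomparable w w')) => //.
- by move=> w; exact: split_weight_gt0.
- by move=> w u; exact: wprod_gt0.
- by move=> w u v uv; apply: sep; rewrite incomparable_cat2l.
- by move=> w w' u v ww; apply: sep; exact: incomparable_cat.
- move=> w u.
  have mass : ((p ord0 * split_weight p' t w * wprod t u * e)%:E <=
      mu (eball (foldr f x (w ++ u)) (d / 4 * wprod s (w ++ u))))%E.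
    rewrite foldr_cat wprod_cat (_ : d / 4 * _ = wprod s w * (wprod s u * (d / 4))); last by ring.
    apply: le_trans (ISM_split_mass fs p0 muE _ _ w t0 nuE).
    rewrite -mulrA EFinM; apply: lee_wpmul2l.
      by rewrite lee_fin mulr_ge0 ?(ltW (p0 _)) ?(ltW (split_weight_gt0 _ p'0 t0)).
    apply: le_trans (self_similar_mass _ _ u fs t0 nuE).
    by rewrite EFinM; apply: lee_wpmul2l => //; rewrite lee_fin (ltW (wprod_gt0 _ _)).
  rewrite powRM ?(ltW (wprod_gt0 _ _)) ?(ltW d4)//.
  apply: le_trans (lee_wpmul2l _ mass); last by rewrite lee_fin mulr_ge0 ?powR_ge0.
  have -> : split_weight a b w = split_weight p' t w * wprod s w `^ r.
    by rewrite (split_weightM p' t (fun i => s i `^ r)) wprod_powR.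
  have -> : wprod b u = wprod t u * wprod s u `^ r by exact: wprod_weight.
  rewrite -EFinM lee_fin wprod_cat (powRM r (ltW (wprod_gt0 w s0)) (ltW (wprod_gt0 u s0))) /C.
  by rewrite le_eqVlt; apply/orP; left; apply/eqP; ring.
- move=> L; have [k Lk] := split_weight_unbounded L th0 a0 b0 aE bE ab.
  exists (words n k); split => //; first exact: uniq_words.
  by move=> u v; exact: incomparable_words.
Qed.

End case_same.

End lower.

(** * The second case: two systems that live apart *)

Section case_distinct.
Context (R : realType) (q : nat) (r : R) (r0 : 0 < r).
Local Notation rV := 'rV[R]_q.
Context (n : nat) (f : 'I_n -> rV -> rV) (s : 'I_n -> R).
Hypothesis fs : forall i, contractive_similitude (f i) (s i).

Let s0 i : 0 < s i. Proof. by have [/andP[]] := fs i. Qed.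
Let s01 i : 0 < s i < 1. Proof. exact: (fs i).1. Qed.

Lemma closure_bounded (U : set rV) : bounded_set U -> bounded_set (closure U).
Proof.
move=> /bounded_enorm[c _ Uc]; apply: (@enorm_bounded _ _ _ c) => x clx.
rewrite leNgt; apply/negP => cx.
have [] := clx (outside c); last by move=> y [/Uc]; rewrite /outside /= leNgt => /negP.
apply: open_nbhs_nbhs; split => //.
rewrite (_ : outside c = (@enorm R q) @^-1` [set t | c < t])//.
by apply: open_comp; [move=> y _; exact: enorm_continuous|exact: open_gt].
Qed.

(** The closed sets to avoid are the complement of [U] and the [f i (closure U)]. *)
Lemma compact_margin (C U : set rV) : compact C -> OSC_set f U -> C `<=` U ->
  (forall i, C `&` (f i @` closure U) = set0) ->
  exists2 e, 0 < e & forall x, C x ->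
    eball x e `<=` U /\ forall i y, U y -> e <= enorm (x - f i y).
Proof.
move=> cC [_ bU oU _ _] CU Cf.
have [e1 e10 He1] := compact_open_margin cC oU CU.
have /choice[e He] : forall i, exists e, 0 < e /\
    forall x, C x -> eball x e `<=` ~` (f i @` closure U).
  move=> i; have [||e e0 H] := @compact_open_margin _ _ C (~` (f i @` closure U)) cC.
  - apply: closed_openC; apply: similitude_closed (fs i) _ _; last exact: closed_closure.
    exact: closure_bounded.
  - by move=> x Cx fx; have : (C `&` (f i @` closure U)) x by []; rewrite Cf.
  - by exists e.
have [m /andP[m0 _] me] := finite_lower_bound (fun i => (He i).1).
exists (Num.min e1 m); first by rewrite lt_min e10.
move=> x Cx; split.
  by move=> y xy; apply: (He1 x Cx); apply: lt_le_trans xy _; rewrite ge_min lexx.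
move=> i y Uy; rewrite leNgt; apply/negP => lt.
apply: ((He i).2 x Cx (f i y)); last by exists y => //; exact: subset_closure.
rewrite /eball /= enormC (lt_le_trans lt)// ge_min; apply/orP; right; exact: me.
Qed.

(** Incomparable words are kept apart by the balls that fit into [U], comparable
    ones by the distance from [C] to the images of [U]. *)
Lemma margin_separation (C U : set rV) e : OSC_set f U -> 0 < e -> C `<=` U ->
  (forall x, C x -> eball x e `<=` U /\ forall i y, U y -> e <= enorm (x - f i y)) ->
  forall x y u v, C x -> C y -> u != v ->
    e * Num.max (wprod s u) (wprod s v) <= enorm (foldr f x u - foldr f y v).
Proof.
move=> oU e0 CU He x y u v Cx Cy uv.
have pref x' y' u' v' : C x' -> C y' -> u' != v' -> (exists w, v' = u' ++ w) ->
    e * Num.max (wprod s u') (wprod s v') <= enorm (foldr f x' u' - foldr f y' v').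
  move=> Cx' Cy' uv' [[|i w] E]; first by rewrite E cats0 eqxx in uv'.
  rewrite E foldr_cat (similitude_word fs) wprod_cat.
  have /max_idPl -> : wprod s u' * wprod s (i :: w) <= wprod s u'.
    by rewrite ler_piMr ?(ltW (wprod_gt0 _ _)) ?wprod_le1.
  rewrite mulrC ler_wpM2l ?(ltW (wprod_gt0 _ _))//=.
  apply: (He x' Cx').2; apply: foldr_invariant (CU _ Cy') => j z.
  exact: (OSC_invariant j oU).
have [inc|/comparable_words[h|h]] := boolP (incomparable u v); last 2 first.
- exact: pref.
- by rewrite maxC enormC; apply: pref => //; rewrite eq_sym.
have h1 := OSC_word_dist fs oU (He x Cx).1 (CU _ Cy) inc.
rewrite incomparableC in inc.
have h2 := OSC_word_dist fs oU (He y Cy).1 (CU _ Cx) inc.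
by rewrite maxr_pMr ?(ltW e0)// ge_max mulrC h1 mulrC enormC h2.
Qed.

Lemma sum_short_words (a : 'I_n -> R) th k : (forall i, 0 < a i) ->
  \sum_(i < n) a i `^ th = 1 ->
  \sum_(w <- [seq w | j <- iota 0 k, w <- words n j]) wprod a w `^ th = k%:R.
Proof.
move=> a0 ath; rewrite big_allpairs_dep.
rewrite (eq_bigr (fun=> 1)) => [|j _].
  by rewrite big_const_seq count_predT size_iota iter_addr addr0.
rewrite (eq_bigr (wprod (fun i => a i `^ th))) => [|w _]; last by rewrite wprod_powR.
by rewrite sum_words_wprod ath expr1n.
Qed.

Lemma uniq_short_words k : uniq [seq w | j <- iota 0 k, w <- words n j].
Proof.
apply: allpairs_uniq_dep; first exact: iota_uniq.
  by move=> j _; exact: uniq_words.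
move=> [i u] [j v] /allpairsPdep[i' [u' [_ ui E]]] /allpairsPdep[j' [v' [_ vj E']]] /=.
case: E ui => -> -> /size_words <-; case: E' vj => -> -> /size_words <- ->.
by [].
Qed.

Context (m : nat) (g : 'I_m -> rV -> rV) (c t : 'I_m -> R) (p : 'I_n.+1 -> R).
Context (nu mu : probability (borel_rV R q) R).
Hypothesis gc : forall i, contractive_similitude (g i) (c i).
Hypothesis p0 : forall i, 0 < p i.
Hypothesis muE : is_ISM f p nu mu.
Hypothesis t01 : forall i, 0 < t i <= 1.
Hypothesis nuE : is_self_similar_measure g t nu.
Let p' (i : 'I_n) := p (lift ord0 i).

(** Each level of words of the [f i] adds [1] to the total weight. *)
Lemma case_distinct_unbounded x d e xi : 0 < xi ->
  \sum_(i < n) (p' i * s i `^ r) `^ (xi / (xi + r)) = 1 ->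
  \sum_(i < m) (t i * c i `^ r) `^ (xi / (xi + r)) = 1 ->
  msupport nu x -> 0 < d -> separated_orbit g c x d -> 0 < e ->
  (forall y z u v, msupport nu y -> msupport nu z -> u != v ->
    e * Num.max (wprod s u) (wprod s v) <= enorm (foldr f y u - foldr f z v)) ->
  forall B, exists n0 : R, forall k : nat, n0 <= k%:R ->
    ((B * k%:R `^ (- (r / xi)))%:E <= quantization_error mu r k `^ r)%E.
Proof.
move=> xi0 aE bE nux d0 sep e0 sepf.
have c0 i : 0 < c i by have [/andP[]] := gc i.
have c01 i : 0 < c i < 1 by exact: (gc i).1.
have t0 i : 0 < t i by have /andP[] := t01 i.
pose a i := p' i * s i `^ r; pose b i := t i * c i `^ r.
have b01 i : 0 < b i < 1 by exact: weight_lt1.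
have a0 i : 0 < a i by rewrite mulr_gt0 ?powR_gt0//; exact: p0.
pose h := Num.min d e; have h0 : 0 < h by rewrite lt_min d0.
have h4 : 0 < h / 4 by rewrite divr_gt0.
have [k k0 nuk] := msupport_ball nux h4.
have p'0 i : 0 < p' i by exact: p0.
have ws0 w : 0 < wprod s w by exact: wprod_gt0.
have wc0 w : 0 < wprod c w by exact: wprod_gt0.
pose C := p ord0 * k * (h / 4) `^ r.
have C0 : 0 < C by rewrite !mulr_gt0// powR_gt0.
have nug w : msupport nu (foldr g x w).
  by apply: foldr_invariant nux => i y; exact: (msupport_invariant gc t0 nuE).
apply: (@pair_lower_unbounded _ _ _ r0 mu m _ (wprod a) b xi C h
  (fun w u => foldr f (foldr g x u) w) (fun w u => wprod s w * wprod c u)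
  (fun w w' => w != w')) => //.
- by move=> w; exact: wprod_gt0.
- by move=> w u; rewrite mulr_gt0.
- move=> w u v uv; rewrite (similitude_word fs) -maxr_pMr ?(ltW (ws0 _))//.
  rewrite mulrCA ler_pM2l//; apply: le_trans (sep _ _ uv).
  by rewrite ler_wpM2r ?ge_min ?lexx// le_max (ltW (wc0 _)).
- move=> w w' u v ww; apply: le_trans (sepf _ _ _ _ (nug u) (nug v) ww).
  have le1 y z : wprod s y * wprod c z <= wprod s y.
    by rewrite ler_piMr ?(ltW (ws0 _)) ?wprod_le1.
  apply: ler_pM.
  - exact: ltW.
  - by rewrite le_max (ltW (mulr_gt0 (ws0 _) (wc0 _))).
  - by rewrite ge_min lexx orbT.
  - by rewrite ge_max !le_max !le1 orbT.
- move=> w u.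
  have mass : ((p ord0 * wprod p' w * wprod t u * k)%:E <=
      mu (eball (foldr f (foldr g x u) w) (h / 4 * (wprod s w * wprod c u))))%E.
    rewrite (_ : h / 4 * _ = wprod s w * (wprod c u * (h / 4))); last by ring.
    apply: le_trans (ISM_mass fs p0 muE _ _ w).
    rewrite (_ : _ * k = wprod p' w * (p ord0 * (wprod t u * k))); last by ring.
    rewrite EFinM; apply: lee_wpmul2l; first by rewrite lee_fin (ltW (wprod_gt0 _ _)).
    apply: le_trans (ISM_ge_nu p0 muE (measurable_eball _ _)).
    rewrite EFinM; apply: lee_wpmul2l; first by rewrite lee_fin ltW.
    apply: le_trans (self_similar_mass _ _ u gc t0 nuE).
    by rewrite EFinM; apply: lee_wpmul2l => //; rewrite lee_fin (ltW (wprod_gt0 _ _)).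
  rewrite powRM ?(ltW h4) ?(ltW (mulr_gt0 (ws0 _) (wc0 _)))//.
  apply: le_trans (lee_wpmul2l _ mass); last by rewrite lee_fin mulr_ge0 ?powR_ge0.
  have -> : wprod a w = wprod p' w * wprod s w `^ r by exact: wprod_weight.
  have -> : wprod b u = wprod t u * wprod c u `^ r by exact: wprod_weight.
  rewrite -EFinM lee_fin (powRM r (ltW (ws0 w)) (ltW (wc0 u))) /C.
  by rewrite le_eqVlt; apply/orP; left; apply/eqP; ring.
- move=> L; exists [seq w | j <- iota 0 (Num.truncn L).+1, w <- words n j]; split => //.
    exact: uniq_short_words.
  by rewrite sum_short_words// ltW// truncnS_gt.
Qed.

End case_distinct.

(** * Finiteness of the upper quantization coefficient *)

Section coefficient.
Context (R : realType) (q : nat) (r : R) (r0 : 0 < r).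
Local Notation rV := 'rV[R]_q.
Implicit Types (P nu mu : probability (borel_rV R q) R).

Lemma upper_coefficient_lty P (xi n0 B : R) :
  (forall k : nat, n0 <= k%:R ->
    (quantization_error P r k `^ r <= (B * k%:R `^ (- (r / xi)))%:E)%E) ->
  (upper_quantization_coefficient P r xi < +oo)%E.
Proof.
move=> H; apply: (@le_lt_trans _ _ B%:E); last exact: ltry.
pose V := [set k : nat | Num.max n0 1 <= k%:R :> R].
pose u (k : nat) : \bar R := ((k%:R `^ (r / xi))%R%:E * quantization_error P r k `^ r)%E.
apply: ge_ereal_inf; exists (ereal_sup [set u k | k in V]).
  by exists V => //; exact: nbhs_infty_ger.
apply: ge_ereal_sup => _ [k + <-]; rewrite /V /u /= ge_max => /andP[/H h k1].
have k0 : 0 < k%:R :> R by exact: lt_le_trans k1.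
apply: le_trans (lee_wpmul2l _ h) _; first by rewrite lee_fin powR_ge0.
by rewrite -EFinM lee_fin powRN mulrCA divff ?mulr1// gt_eqF// powR_gt0.
Qed.

(** A finite coefficient would bound the sequence from some index on. *)
Lemma upper_coefficient_pinfty P (xi : R) :
  (forall B, exists n0 : R, forall k : nat, n0 <= k%:R ->
    ((B * k%:R `^ (- (r / xi)))%:E <= quantization_error P r k `^ r)%E) ->
  ~ (upper_quantization_coefficient P r xi < +oo)%E.
Proof.
move=> H /ereal_inf_lt[y [V [N _ NV] <-]].
set S := ereal_sup _ => Slt.
have V_ge k : (N <= k)%N -> ((k%:R `^ (r / xi))%R%:E * quantization_error P r k `^ r <= S)%E.
  by move=> Nk; apply: ereal_sup_ubound; exists k => //; exact: NV.
have S0 : (0 <= S)%E.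
  apply: le_trans (V_ge N (leqnn _)); apply: mule_ge0; first by rewrite lee_fin powR_ge0.
  exact: poweR_ge0.
have Sfin : S \is a fin_num by rewrite ge0_fin_numE.
have [n0 Hn0] := H (fine S + 1).
pose k := maxn N.+1 (Num.truncn n0).+1.
have kn0 : n0 <= k%:R.
  by rewrite ltW// (lt_le_trans (truncnS_gt _))// ler_nat leq_max leqnn orbT.
have k0 : 0 < k%:R :> R by rewrite ltr0n leq_max.
have := V_ge k; rewrite leq_max leqnSn /= => /(_ isT).
apply/negP; rewrite -ltNge -(fineK Sfin).
apply: lt_le_trans (lee_wpmul2l _ (Hn0 _ kn0)); last by rewrite lee_fin powR_ge0.
rewrite -EFinM lte_fin powRN mulrCA divff ?mulr1; first by rewrite ltrDl.
by rewrite gt_eqF// powR_gt0.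
Qed.

Lemma outside_le P c d : c <= d -> P (outside c) = 0%E -> P (outside d) = 0%E.
Proof.
move=> cd Pc; apply/eqP; rewrite eq_le measure_ge0 andbT -Pc.
apply: le_measure; rewrite ?inE; try exact: measurable_outside.
by move=> x; rewrite /outside /=; exact: le_lt_trans.
Qed.

Lemma probability_vector_le1 n (p : 'I_n -> R) : positive_probability_vector p ->
  forall i, 0 < p i <= 1.
Proof.
move=> [p0 psum] i; rewrite p0 -psum (bigD1 i)//= lerDl sumr_ge0// => j _.
exact: ltW.
Qed.

(** The two cases provide the same data: a point of the support of [nu] with
    separated orbits under both systems, and an unbounded lower estimate when the
    exponents agree. *)
Lemma case_data N (f : 'I_N -> rV -> rV) (s : 'I_N -> R) (p : 'I_N.+1 -> R)
    (E : set rV) nu mu (xi1 xi2 : R) :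
  (2 <= N)%N -> (forall i, contractive_similitude (f i) (s i)) ->
  positive_probability_vector p -> compact (msupport nu) -> is_ISM f p nu mu ->
  is_exponent r (fun i : 'I_N => p (lift ord0 i)) s xi2 ->
  case_i r f s nu xi1 \/ case_ii r f E nu xi1 ->
  exists (M : nat) (g : 'I_M -> rV -> rV) (c t : 'I_M -> R) (x : rV) (d : R),
    [/\ (0 < M)%N /\ (forall i, contractive_similitude (g i) (c i)),
        positive_probability_vector t /\ is_self_similar_measure g t nu,
        is_exponent r t c xi1 /\ msupport nu x,
        [/\ 0 < d, separated_orbit g c x d & separated_orbit f s x d] &
        xi1 = xi2 -> forall B, exists n0 : R, forall k : nat, n0 <= k%:R ->
          ((B * k%:R `^ (- (r / xi1)))%:E <= quantization_error mu r k `^ r)%E].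
Proof.
move=> N2 fs pp cC muE [xi20 xi2E] hcase.
have [p0 psum] := pp.
have bC : exists K, forall x, msupport nu x -> enorm x <= K.
  by have [K _ HK] := bounded_enorm (compact_bounded cC); exists K.
have common M (g : 'I_M -> rV -> rV) (c t : 'I_M -> R) : (0 < M)%N ->
    (forall i, contractive_similitude (g i) (c i)) -> OSC g ->
    positive_probability_vector t -> is_self_similar_measure g t nu ->
    exists x d, [/\ msupport nu x, 0 < d & separated_orbit g c x d].
  move=> M0 gc oscg [t0 tsum] nuE.
  have [d _ nud] : exists2 d, 0 <= d & nu (outside d) = 0%E.
    apply: (concentrated gc (fun i => ltW (t0 i))); first by rewrite tsum.
    by move=> d _; rewrite -nuE//; exact: measurable_outside.
  have [a Ca] := msupport_neq0 nud.
  exact: (strong_separation gc oscg Ca bC (msupport_invariant gc t0 nuE)).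
case: hcase => [[oscf [t [tp nuE [xi10 xi1E]]]]|].
  have N0 : (0 < N)%N by exact: leq_trans N2.
  have [x [d [Cx d0 sep]]] := common _ _ _ _ N0 fs oscf tp nuE.
  exists N, f, s, t, x, d; split => // xi12.
  rewrite xi12 in xi1E *.
  exact: (case_same_unbounded r0 fs p0 psum muE (probability_vector_le1 tp) tp.2 nuE
    xi20 xi2E xi1E Cx d0 sep).
move=> [[M [g [c [t [M2 [gc oscg] tp nuE [xi10 xi1E]]]]]] [U [oU [_ CU] _ Cf]]].
have M0 : (0 < M)%N by exact: leq_trans M2.
have [x [d [Cx d0 sep]]] := common _ _ _ _ M0 gc oscg tp nuE.
have [e e0 He] := compact_margin fs cC oU CU Cf.
have sepf := margin_separation fs oU e0 CU He.
exists M, g, c, t, x, (Num.min d e); split => //.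
- split; first by rewrite lt_min d0.
  + apply: separated_orbit_le sep; last by rewrite ge_min lexx.
    by move=> i; have [/andP[]] := gc i.
  + apply: (@separated_orbit_le _ _ _ _ _ _ e).
    * by move=> i; have [/andP[]] := fs i.
    * by rewrite ge_min lexx orbT.
    * move=> u v uv; apply: sepf => //.
      by apply: contraTneq uv => ->; rewrite incomparable_irr.
- move=> xi12.
  rewrite xi12 in xi1E *.
  exact: (case_distinct_unbounded r0 fs gc p0 muE (probability_vector_le1 tp) nuE
    xi20 xi2E xi1E Cx d0 sep e0 sepf).
Qed.

End coefficient.

Theorem mainTheorem3 (R : realType) (q N : nat) (r : R)
  (f : 'I_N -> 'rV[R]_q -> 'rV[R]_q) (s : 'I_N -> R) (p : 'I_N.+1 -> R)
  (E : set 'rV[R]_q) (nu mu : probability (borel_rV R q) R) (xi1 xi2 : R)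
  (hq : (1 <= q)%N) (hN : (2 <= N)%N) (hr : 0 < r)
  (hf : forall i, contractive_similitude (f i) (s i))
  (hE : is_self_similar_set f E)
  (hp : positive_probability_vector p)
  (hnu : compact (msupport nu))
  (hmu : is_ISM f p nu mu)
  (hxi2 : is_exponent r (fun i : 'I_N => p (lift ord0 i)) s xi2)
  (hcase : case_i r f s nu xi1 \/ case_ii r f E nu xi1) :
  let xi := Num.max xi1 xi2 in
  ((upper_quantization_coefficient mu r xi < +oo)%E <-> xi1 <> xi2) /\
  (xi1 <> xi2 ->
   same_order (fun n : nat => (quantization_error mu r n `^ r)%E)
              (fun n : nat => (n%:R `^ (- (r / xi)))%:E)).
Proof.
have [M [g [c [t [x [d [[M0 gc] [tp nuE] [[xi10 xi1E] Cx] [d0 sepg sepf] unb]]]]]]] :=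
  case_data hr hN hf hp hnu hmu hxi2 hcase.
have [xi20 xi2E] := hxi2.
have p01 := probability_vector_le1 hp; have t01 := probability_vector_le1 tp.
have [p0 psum] := hp; have [t0 tsum] := tp.
have N0 : (0 < N)%N by exact: leq_trans hN.
move=> xi.
have upper : xi1 <> xi2 -> exists n0 B : R, 0 < B /\ forall k : nat, n0 <= k%:R ->
    (quantization_error mu r k `^ r <= (B * k%:R `^ (- (r / xi)))%:E)%E.
  move=> xi12.
  have [d1 d10 nud1] : exists2 d1, 0 <= d1 & nu (outside d1) = 0%E.
    apply: (concentrated gc (fun i => ltW (t0 i))); first by rewrite tsum.
    by move=> e _; rewrite -nuE//; exact: measurable_outside.
  have [d2 d12 mud2] : exists2 d2, d1 <= d2 & mu (outside d2) = 0%E.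
    apply: (concentrated hf (fun i => ltW (p0 (lift ord0 i)))).
      by rewrite -psum big_ord_recl lerDr ltW.
    move=> e d1e; rewrite [leLHS]hmu; last exact: measurable_outside.
    by rewrite (outside_le d1e nud1) mule0 add0e.
  have d20 : 0 <= d2 by exact: le_trans d12.
  have nud2 := outside_le d12 nud1.
  have th_gt0 y : 0 < y -> 0 < y / (y + r) by move=> y0; rewrite divr_gt0 ?addr_gt0.
  have th_lt y z : 0 < y -> 0 < z -> y < z -> y / (y + r) < z / (z + r).
    move=> y0 z0 yz; rewrite ltr_pdivrMr ?addr_gt0// mulrAC ltr_pdivlMr ?addr_gt0//.
    by rewrite !mulrDr mulrC ltrD2l mulrC (mulrC z) ltr_pM2l.
  have th12 : xi1 / (xi1 + r) != xi2 / (xi2 + r).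
    by have [lt|lt|//] := ltgtP xi1 xi2; rewrite neq_lt; [|rewrite orbC]; rewrite th_lt.
  have maxth : Num.max (xi1 / (xi1 + r)) (xi2 / (xi2 + r)) = xi / (xi + r).
    rewrite /xi; have [lt|lt|//] := ltgtP xi1 xi2.
      by rewrite max_r// ltW// th_lt.
    by rewrite max_l// ltW// th_lt.
  have [C C0 nuC] := self_similar_upper hr M0 (th_gt0 _ xi10) gc t01 nuE xi1E
    (powR_ge0 d2 r) (approximable_outside hr d20 nud2).
  have [A A0 muA] := ISM_upper hr N0 hf p01 hmu (th_gt0 _ xi10) (th_gt0 _ xi20) th12 xi2E
    (powR_ge0 d2 r) (approximable_outside hr d20 mud2) C0 nuC.
  rewrite maxth in muA.
  have xi0 : 0 < xi by rewrite lt_max xi10.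
  have [B B0 HB] := upper_rate hr xi0 (powR_ge0 d2 r) A0 muA.
  by exists A, B.
split.
  split; first by move=> lt xi12; move: lt; rewrite /xi -xi12 maxxx;
    exact: (upper_coefficient_pinfty (unb xi12)).
  by move=> /upper[n0 [B [_ H]]]; exact: upper_coefficient_lty H.
move=> xi12; have [n1 [B [B0 HB]]] := upper xi12.
have [e e0 nue] := msupport_ball Cx (divr_gt0 d0 (ltr0n R 4)).
have lower : exists n0 b : R, 0 < b /\ forall k : nat, n0 <= k%:R ->
    ((b * k%:R `^ (- (r / xi)))%:E <= quantization_error mu r k `^ r)%E.
  have C0 : 0 < p ord0 * e by rewrite mulr_gt0.
  rewrite /xi; have [_|_] := leP xi1 xi2.
    apply: (orbit_lower_rate hr hf (fun i => p01 (lift ord0 i)) xi20 xi2E d0 sepf C0).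
    move=> u; rewrite mulrC (mulrC (d / 4)).
    apply: le_trans (ISM_mass hf p0 hmu x (d / 4) u).
    rewrite EFinM; apply: lee_wpmul2l; first by rewrite lee_fin ltW// wprod_gt0.
    apply: le_trans (ISM_ge_nu p0 hmu (measurable_eball _ _)).
    by rewrite EFinM; apply: lee_wpmul2l => //; rewrite lee_fin ltW.
  apply: (orbit_lower_rate hr gc t01 xi10 xi1E d0 sepg C0) => u.
  apply: le_trans (ISM_ge_nu p0 hmu (measurable_eball _ _)).
  rewrite (_ : _ * wprod t u = p ord0 * (wprod t u * e)); last by ring.
  rewrite (mulrC (d / 4)) EFinM; apply: lee_wpmul2l; first by rewrite lee_fin ltW.
  apply: le_trans (self_similar_mass x (d / 4) u gc t0 nuE).
  by rewrite EFinM; apply: lee_wpmul2l => //; rewrite lee_fin ltW// wprod_gt0.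
have [n2 [b [b0 Hb]]] := lower.
exists b, B; split => //.
near=> k; rewrite -!EFinM; split.
  by apply: Hb; near: k; exact: nbhs_infty_ger.
by apply: HB; near: k; exact: nbhs_infty_ger.
Unshelve. all: by end_near. Qed.
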